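(* Up to isomorphism there exist exactly $17$ nilpotent Jordan algebras of dimension $4$ over $\mathbb{R}$: every such algebra is isomorphic to one of the following pairwise non-isomorphic nilpotent Jordan algebras, each with basis $a,b,c,d$ and the indicated nonzero products (where a superscript $\alpha=\pm1$ indicates two algebras, one for $\alpha=1$ and one for $\alpha=-1$). Nilpotent Jordan algebras with central component: - $J_{4,1}$: all products are zero; - $J_{4,2}$: $a^2=b$; - $J_{4,3}^{\alpha=\pm1}$: $a^2=c,\ b^2=\alpha c$; - $J_{4,4}$: $a^2=b,\ a\circ b=c$. Nilpotent Jordan algebras without central component: - $J_{4,5}^{\alpha=\pm1}$: $a^2=d,\ b^2=d,\ c^2=\alpha d$; - $J_{4,6}$: $a^2=b,\ b\circ c=d$; - $J_{4,7}$: $a^2=b,\ a\circ b=d,\ c^2=d$; - $J_{4,8}^{\alpha=\pm1}$: $a^2=c,\ b^2=\alpha c,\ a\circ c=d$; - $J_{4,9}$: $a^2=c,\ b^2=-c,\ a\circ c=d,\ b\circ c=d$; - $J_{4,10}$: $a^2=c,\ b^2=-c,\ a\circ c=d,\ b\circ c=d,\ a\circ b=d$; - $J_{4,11}$: $a^2=b,\ a\circ b=c,\ a\circ c=d,\ b^2=d$; - $J_{4,12}$: $a^2=c,\ a\circ b=d$; - $J_{4,13}^{\alpha=\pm1}$: $a^2=c,\ b^2=\alpha c,\ a\circ b=d$.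
   Context: A Jordan algebra over a field $K$ is a $K$-vector space $J$ with a symmetric bilinear product $\circ:J\times J\to J$ satisfying $x^2\circ(x\circ y)=x\circ(x^2\circ y)$ for all $x,y\in J$, where $x^2=x\circ x$. Set $c^1(J)=J$ and $c^m(J)=c^{m-1}(J)\circ J$ (the span of the products) for $m\geq 2$; $J$ is nilpotent if $c^n(J)=0$ for some $n$. The centre is $Z(J)=\{x\in J: x\circ y=0\ \forall y\in J\}$. $J$ has a central component if $J=I_1\oplus I_2$ is a direct sum of two ideals with $I_2$ nonzero and contained in $Z(J)$. In the multiplication tables, all products of basis vectors that are not listed (and do not follow from commutativity) are zero. *)

(* Defs.v *)
From HB Require Import structures.
From mathcomp Require Import all_boot all_order all_algebra.
From mathcomp Require Import reals.

Set Implicit Arguments.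
Unset Strict Implicit.
Unset Printing Implicit Defensive.

Import GRing.Theory.
Local Open Scope ring_scope.

(* A finite-dimensional, not necessarily associative or unital algebra. *)
Record nalgType (K : fieldType) := NAlg {
  nalg_carrier :> vectType K;
  nalg_mul : {bilinear nalg_carrier -> nalg_carrier -> nalg_carrier}
}.

Declare Scope nalg_scope.
Notation "x ∘ y" := (nalg_mul _ x y)
  (at level 40, left associativity) : nalg_scope.
Local Open Scope nalg_scope.

Section NAlgTheory.
Variables (K : fieldType) (J : nalgType K).
Implicit Types (x y : J) (U V W I : {vspace J}).

Definition is_jordan : Prop :=
  (forall x y, x ∘ y = y ∘ x) /\
  (forall x y, (x ∘ x) ∘ (x ∘ y) = x ∘ ((x ∘ x) ∘ y)).

(* The span of all products u ∘ v with u in U and v in V (see nalg_prodP). *)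
Definition nalg_prod U V : {vspace J} :=
  <<[seq u ∘ v | u <- vbasis U, v <- vbasis V]>>%VS.

Lemma nalg_prodP U V W :
  reflect {in U & V, forall u v, u ∘ v \in W} (nalg_prod U V <= W)%VS.
Proof.
apply: (iffP idP) => [/subvP sUVW u v Uu Vv | sUVW]; last first.
  apply/span_subvP => _ /allpairsP[[u v] /= [Uu Vv ->]].
  by rewrite sUVW ?vbasis_mem.
apply: sUVW; rewrite (coord_vbasis Uu) (coord_vbasis Vv).
rewrite linear_sumlz; apply: memv_suml => i _.
rewrite linear_sumr; apply: memv_suml => j _.
rewrite linearZl_LR linearZr_LR !memvZ // memv_span //.
by apply/allpairsP; exists ((vbasis U)`_i, (vbasis V)`_j); rewrite !memt_nth.
Qed.

(* c^m(J), meaningful for m >= 1: c^1(J) = J, c^(m+1)(J) = c^m(J) ∘ J. *)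
Definition cpow m : {vspace J} :=
  iter m.-1 (fun U => nalg_prod U fullv) fullv.

Definition is_nilpotent : Prop := exists2 n, (0 < n)%N & cpow n = 0%VS.

Definition in_centre x : Prop := forall y, x ∘ y = 0.

Definition is_ideal I : Prop :=
  forall x y, x \in I -> (x ∘ y \in I) /\ (y ∘ x \in I).

Definition has_central_component : Prop :=
  exists I1 I2 : {vspace J},
    [/\ is_ideal I1 /\ is_ideal I2,
        (I1 + I2)%VS = fullv /\ directv (I1 + I2),
        I2 <> 0%VS &
        forall x, x \in I2 -> in_centre x].

End NAlgTheory.

Definition nalg_iso (K : fieldType) (A B : nalgType K) : Prop :=
  exists2 f : {linear A -> B}, bijective f & forall x y, f (x ∘ y) = f x ∘ f y.

(* An entry (i, j, v) of a multiplication table means e_i ∘ e_j = e_j ∘ e_i = v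
   on the standard basis of K^n; unlisted products are 0.  Each unordered pair
   {i, j} is to be listed at most once. *)
Section Table.
Variables (K : fieldType) (n : nat).

Definition table := seq ('I_n * 'I_n * 'rV[K]_n).

Definition table_entry (t : table) (i j : 'I_n) : 'rV[K]_n :=
  \sum_(p <- t | (p.1 == (i, j)) || (p.1 == (j, i))) p.2.

Definition table_mul (t : table) (x y : 'rV[K]_n) : 'rV[K]_n :=
  \sum_i \sum_j (x 0 i * y 0 j) *: table_entry t i j.

Lemma table_mul_bilinear t : bilinear_for *:%R *:%R (table_mul t).
Proof.
split=> [y c x x' | x c y y'] /=; rewrite /table_mul scaler_sumr -big_split /=;
  apply: eq_bigr => i _; rewrite scaler_sumr -big_split /=;
  apply: eq_bigr => j _; rewrite !mxE scalerA -scalerDl; congr (_ *: _).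
  by rewrite mulrDl mulrA.
by rewrite mulrDr mulrCA.
Qed.

HB.instance Definition _ t :=
  bilinear_isBilinear.Build K 'rV[K]_n 'rV[K]_n 'rV[K]_n *:%R *:%R
    (table_mul t) (table_mul_bilinear t).

Definition table_alg (t : table) : nalgType K :=
  @NAlg K 'rV[K]_n (table_mul t).

Lemma table_mul_delta t i j :
  table_mul t (delta_mx 0 i) (delta_mx 0 j) = table_entry t i j.
Proof.
rewrite /table_mul (bigD1 i) //= (bigD1 j) //= !mxE !eqxx mulr1 scale1r.
rewrite big1 ?addr0 => [|k /negPf nkj]; last first.
  by rewrite !mxE nkj mulr0 scale0r.
rewrite big1 ?addr0 // => k /negPf nki; rewrite big1 // => l _.
by rewrite !mxE nki mul0r scale0r.
Qed.

End Table.

Section J4.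
Variable K : fieldType.
Implicit Type alpha : K.

Let a : 'I_4 := inord 0.
Let b : 'I_4 := inord 1.
Let c : 'I_4 := inord 2.
Let d : 'I_4 := inord 3.
Let e (i : 'I_4) : 'rV[K]_4 := delta_mx 0 i.

Definition J4_1 : table K 4 := [::].
Definition J4_2 : table K 4 := [:: (a, a, e b)].
Definition J4_3 alpha : table K 4 := [:: (a, a, e c); (b, b, alpha *: e c)].
Definition J4_4 : table K 4 := [:: (a, a, e b); (a, b, e c)].

Definition J4_5 alpha : table K 4 :=
  [:: (a, a, e d); (b, b, e d); (c, c, alpha *: e d)].
Definition J4_6 : table K 4 := [:: (a, a, e b); (b, c, e d)].
Definition J4_7 : table K 4 := [:: (a, a, e b); (a, b, e d); (c, c, e d)].
Definition J4_8 alpha : table K 4 :=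
  [:: (a, a, e c); (b, b, alpha *: e c); (a, c, e d)].
Definition J4_9 : table K 4 :=
  [:: (a, a, e c); (b, b, - e c); (a, c, e d); (b, c, e d)].
Definition J4_10 : table K 4 :=
  [:: (a, a, e c); (b, b, - e c); (a, c, e d); (b, c, e d);
   (a, b, e d)].
Definition J4_11 : table K 4 :=
  [:: (a, a, e b); (a, b, e c); (a, c, e d); (b, b, e d)].
Definition J4_12 : table K 4 := [:: (a, a, e c); (a, b, e d)].
Definition J4_13 alpha : table K 4 :=
  [:: (a, a, e c); (b, b, alpha *: e c); (a, b, e d)].

(* The first five entries are the algebras with a central component. *)
Definition J4_tables : 17.-tuple (table K 4) :=
  [tuple J4_1; J4_2; J4_3 1; J4_3 (-1); J4_4;
         J4_5 1; J4_5 (-1); J4_6; J4_7; J4_8 1; J4_8 (-1);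
         J4_9; J4_10; J4_11; J4_12; J4_13 1; J4_13 (-1)].

Definition J4 (i : 'I_17) : nalgType K := table_alg (tnth J4_tables i).

End J4.

(* Main.v *)
Require Import Defs.
From HB Require Import structures.
From mathcomp Require Import all_boot all_order all_algebra.
From mathcomp Require Import reals.
From mathcomp Require Import ring lra zify.

Set Implicit Arguments.
Unset Strict Implicit.
Unset Printing Implicit Defensive.

Import Order.TTheory GRing.Theory Num.Theory.
Local Open Scope ring_scope.
Local Open Scope nalg_scope.

(* A nilpotent algebra J has a full flag of ideals J = W0 > W1 > ... > W4 = 0 with
   W_i ∘ J inside W_{i+1}, so in a basis adapted to the flag the product of a
   four-dimensional commutative J is given by ten structure constants.  The Jordan
   identity is a short list of polynomial equations in these constants, and every
   solution reaches one of the 17 tables through explicit changes of basis, square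
   roots of positive scalars being the only irrational numbers needed.
   The 17 algebras are separated by isomorphism-invariant sentences such as "x^2 = 0
   only for central x" or "x^3 = 0 and y^3 = 0 imply (x + y)^3 = 0".  A central
   component would provide a central element outside J ∘ J; in the algebras of
   index at least 5 every central element is a product. *)

(** * Isomorphisms and coordinates *)

Section Iso.
Variable K : fieldType.
Implicit Types A B C : nalgType K.

Lemma nalg_iso_sym A B : nalg_iso A B -> nalg_iso B A.
Proof.
case=> f [g fK gK] fM.
have gL : linear g by move=> k x y; apply: (can_inj fK); rewrite linearP !gK.
pose gl := GRing.isLinear.Build _ _ _ _ g gL.
pose g' : {linear B -> A} := HB.pack g gl.
exists g'; first by exists f.
by move=> x y; apply: (can_inj fK); rewrite fM !gK.
Qed.

Lemma nalg_iso_trans A B C : nalg_iso A B -> nalg_iso B C -> nalg_iso A C.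
Proof.
case=> f fB fM [g gB gM]; exists (g \o f); first exact: bij_comp.
by move=> x y /=; rewrite fM gM.
Qed.

End Iso.

Section Row4.
Variable K : fieldType.
Implicit Types (x y k : K) (v : 'rV[K]_4) (p : seq K).

Definition row4 x0 x1 x2 x3 : 'rV[K]_4 :=
  \row_i nth 0 [:: x0; x1; x2; x3] i.

Lemma row4P v : exists x0 x1 x2 x3, v = row4 x0 x1 x2 x3.
Proof.
exists (v 0 (inord 0)), (v 0 (inord 1)), (v 0 (inord 2)), (v 0 (inord 3)).
apply/rowP=> i; rewrite mxE; case: i => [[|[|[|[|//]]]] lti] /=; congr (v 0 _);
  by apply/val_inj; rewrite /= inordK.
Qed.

Lemma row4_inj x0 x1 x2 x3 y0 y1 y2 y3 :
  row4 x0 x1 x2 x3 = row4 y0 y1 y2 y3 -> [/\ x0 = y0, x1 = y1, x2 = y2 & x3 = y3].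
Proof.
move=> /rowP E; split; [have := E (inord 0) | have := E (inord 1)
  | have := E (inord 2) | have := E (inord 3)]; by rewrite !mxE inordK.
Qed.

Lemma row4_0 : row4 0 0 0 0 = 0.
Proof. by apply/rowP=> -[[|[|[|[|//]]]] lti]; rewrite !mxE. Qed.

Lemma row4D x0 x1 x2 x3 y0 y1 y2 y3 :
  row4 x0 x1 x2 x3 + row4 y0 y1 y2 y3 = row4 (x0 + y0) (x1 + y1) (x2 + y2) (x3 + y3).
Proof. by apply/rowP=> -[[|[|[|[|//]]]] lti]; rewrite !mxE. Qed.

Lemma row4Z k x0 x1 x2 x3 :
  k *: row4 x0 x1 x2 x3 = row4 (k * x0) (k * x1) (k * x2) (k * x3).
Proof. by apply/rowP=> -[[|[|[|[|//]]]] lti]; rewrite !mxE. Qed.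

Lemma row4E x0 x1 x2 x3 :
  ((row4 x0 x1 x2 x3 0 (inord 0) = x0) * (row4 x0 x1 x2 x3 0 (inord 1) = x1) *
   (row4 x0 x1 x2 x3 0 (inord 2) = x2) * (row4 x0 x1 x2 x3 0 (inord 3) = x3))%type.
Proof. by rewrite /row4 !mxE !inordK. Qed.

Lemma delta_row4 :
  ((delta_mx 0 (inord 0) = row4 1 0 0 0) * (delta_mx 0 (inord 1) = row4 0 1 0 0) *
   (delta_mx 0 (inord 2) = row4 0 0 1 0) * (delta_mx 0 (inord 3) = row4 0 0 0 1))%type.
Proof.
by do !split; apply/rowP=> -[[|[|[|[|//]]]] lti]; rewrite !mxE eqxx -val_eqE /= inordK.
Qed.

(** Exchanging the sums leaves one term per table entry. An off-diagonal entry serves two index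
    pairs, a diagonal one a single pair, whence the [if]. The right-hand side unfolds along a
    concrete list. *)
Lemma table_mulE n (t : table K n) (x y : 'rV[K]_n) :
  table_mul t x y = \sum_(e <- t) (x 0 e.1.1 * y 0 e.1.2 +
    (if e.1.1 == e.1.2 then 0 else x 0 e.1.2 * y 0 e.1.1)) *: e.2.
Proof.
rewrite /table_mul /table_entry.
under eq_bigr => i _ do under eq_bigr => j _ do rewrite big_mkcond scaler_sumr.
under eq_bigr => i _ do rewrite exchange_big.
rewrite exchange_big; apply: eq_bigr => -[[k l] v] _ /=.
rewrite pair_bigA /= (bigD1 (k, l)) //= eqxx scalerDl; congr (_ + _).
case: eqVneq => [<- | nkl].
  rewrite scale0r big1 // => -[i j] /= nij.
  case: ifP => [/orP[] /eqP[ki kj]|]; last by rewrite scaler0.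
    by rewrite -ki -kj eqxx in nij.
  by rewrite -ki -kj eqxx in nij.
rewrite (bigD1 (l, k)) /=; last by rewrite xpair_eqE negb_and eq_sym nkl.
rewrite eqxx orbT big1 ?addr0 // => -[i j] /= /andP[nij nji].
case: ifP => [/orP[] /eqP[ki lj]|]; last by rewrite scaler0.
  by rewrite -ki -lj eqxx in nij.
by rewrite -ki -lj eqxx in nji.
Qed.

(* [p] lists the ten structure constants in a basis adapted to a flag; a list shorter
   than ten entries is completed with zeros by [nth]. *)
Definition tri (p : seq K) : table K 4 :=
  let e (k : nat) : 'rV_4 := delta_mx 0 (inord k) in
  [:: (inord 0, inord 0, p`_0 *: e 1 + p`_1 *: e 2 + p`_2 *: e 3);
      (inord 0, inord 1, p`_3 *: e 2 + p`_4 *: e 3);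
      (inord 1, inord 1, p`_5 *: e 2 + p`_6 *: e 3);
      (inord 0, inord 2, p`_7 *: e 3); (inord 1, inord 2, p`_8 *: e 3);
      (inord 2, inord 2, p`_9 *: e 3)].

Definition tri_alg p : nalgType K := table_alg (tri p).

Lemma inord4_eq i j : (i < 4)%N -> (j < 4)%N ->
  ((inord i : 'I_4) == inord j) = (i == j).
Proof. by move=> lti ltj; rewrite -val_eqE /= !inordK. Qed.

Lemma tri_mulE p x0 x1 x2 x3 y0 y1 y2 y3 :
  table_mul (tri p) (row4 x0 x1 x2 x3) (row4 y0 y1 y2 y3) =
  row4 0 (p`_0 * (x0 * y0))
    (p`_1 * (x0 * y0) + p`_3 * (x0 * y1 + x1 * y0) + p`_5 * (x1 * y1))
    (p`_2 * (x0 * y0) + p`_4 * (x0 * y1 + x1 * y0) + p`_6 * (x1 * y1) +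
     p`_7 * (x0 * y2 + x2 * y0) + p`_8 * (x1 * y2 + x2 * y1) + p`_9 * (x2 * y2)).
Proof.
rewrite table_mulE !big_cons big_nil /= !inord4_eq //= !row4E !delta_row4.
rewrite !(row4Z, row4D) -row4_0 !row4D; congr row4; ring.
Qed.

End Row4.

(* In the order of [J4_tables], trailing zeros omitted. *)
Definition J4_pars (R : fieldType) : seq (seq R) :=
  [:: [::]; [:: 1]; [:: 0; 1; 0; 0; 0; 1]; [:: 0; 1; 0; 0; 0; - 1];
    [:: 1; 0; 0; 1];
    [:: 0; 0; 1; 0; 0; 0; 1; 0; 0; 1]; [:: 0; 0; 1; 0; 0; 0; 1; 0; 0; - 1];
    [:: 1; 0; 0; 0; 0; 0; 0; 0; 1]; [:: 1; 0; 0; 0; 1; 0; 0; 0; 0; 1];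
    [:: 0; 1; 0; 0; 0; 1; 0; 1]; [:: 0; 1; 0; 0; 0; - 1; 0; 1];
    [:: 0; 1; 0; 0; 0; - 1; 0; 1; 1]; [:: 0; 1; 0; 0; 1; - 1; 0; 1; 1];
    [:: 1; 0; 0; 1; 0; 0; 1; 1]; [:: 0; 1; 0; 0; 1];
    [:: 0; 1; 0; 0; 1; 1]; [:: 0; 1; 0; 0; 1; - 1]].

Definition J4_par (R : fieldType) (i : 'I_17) : seq R := nth [::] (J4_pars R) i.

(** In each of the 17 tables a product of basis vectors involves only vectors later than both
    factors, so the standard basis is already adapted to a flag. *)
Lemma J4_mulE (R : fieldType) (i : 'I_17) x y :
  table_mul (tnth (J4_tables R) i) x y = table_mul (tri (J4_par R i)) x y.
Proof.
have [x0 [x1 [x2 [x3 ->]]]] := row4P x; have [y0 [y1 [y2 [y3 ->]]]] := row4P y.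
rewrite tri_mulE table_mulE (tnth_nth [::]) /J4_par /J4_pars.
case: i; do 17?[case=> [_ /=|]]; last by [].
all: rewrite ?big_cons big_nil /= ?inord4_eq //= ?row4E ?delta_row4.
all: rewrite ?(row4Z, row4D) -row4_0 -?scaleN1r ?row4Z ?row4D ?addr0; congr row4; ring.
Qed.

Lemma J4_iso_tri (R : fieldType) (i : 'I_17) : nalg_iso (J4 R i) (tri_alg (J4_par R i)).
Proof.
exists idfun; first by exists id.
by move=> x y /=; rewrite J4_mulE.
Qed.

(** * A basis adapted to a flag *)

Section Flag.
Variables (K : fieldType) (J : nalgType K).
Implicit Types (U V W : {vspace J}).

Lemma nalg_prodS U V W : (U <= V)%VS -> (nalg_prod U W <= nalg_prod V W)%VS.
Proof.
move=> /subvP sUV; apply/nalg_prodP => u w Uu Ww.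
have /nalg_prodP := subvv (nalg_prod V W); apply=> //; exact: sUV.
Qed.

(** Equality would, by monotonicity, keep [U] inside every [cpow n], hence inside 0. *)
Lemma nilpotent_prod_neq U : is_nilpotent J -> U != 0%VS -> nalg_prod U fullv != U.
Proof.
case=> n n0 cn0; apply: contra => /eqP UU; rewrite -subv0 -cn0.
case: n {cn0} n0 => // n _; elim: n => [|n IHn]; first exact: subvf.
by rewrite -UU; apply: nalg_prodS.
Qed.

Lemma flag_step U : is_nilpotent J -> U != 0%VS -> (nalg_prod U fullv <= U)%VS ->
  exists e W, [/\ (nalg_prod U fullv <= W <= U)%VS, e \in U,
    (\dim W < \dim U)%N & forall x, x \in U -> exists k, x - k *: e \in W].
Proof.
move=> nilJ U0 sVU; set V := nalg_prod U fullv in sVU *.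
(* [C] is a complement of [V] in [U], nonzero because [V] is proper. Splitting the line of [e] off
   [C] leaves [D], and [V + D] serves as [W]. *)
pose C := (U :\: V)%VS; pose e := vpick C; pose D := (C :\: <[e]>)%VS.
have defU : (C + V)%VS = U by rewrite addv_diff; apply/addv_idPl.
have C0 : C != 0%VS.
  apply: contra (nilpotent_prod_neq nilJ U0) => /eqP C0.
  by rewrite -[X in _ == X]defU C0 add0v.
have Ce : e \in C by apply: memv_pick.
have defC : (D + <[e]>)%VS = C by rewrite addv_diff; apply/addv_idPl; rewrite -memvE.
exists e, (V + D)%VS; split.
- by rewrite addvSl -defU [(C + V)%VS]addvC addvS // diffvSl.
- by rewrite -defU memvE addvC -[X in (X <= _)%VS]add0v addvS ?sub0v // -memvE.
- have dU : \dim U = (\dim C + \dim V)%N.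
    by rewrite -defU dimv_disjoint_sum // capv_diff.
  have dC : \dim C = (\dim D + 1)%N.
    by rewrite -defC dimv_disjoint_sum ?capv_diff // dim_vline vpick0 C0.
  rewrite dU dC addn1 addnC addnS ltnS addnC.
  by apply: leq_trans (dimv_add_leqif _ _) _; rewrite addnC.
- move=> x; rewrite -{1}defU -defC -addvA [(<[e]> + V)%VS]addvC addvA [(D + V)%VS]addvC.
  move=> /memv_addP[w Ww [_ /vlineP[k ->] ->]].
  by exists k; rewrite addrK.
Qed.

End Flag.

Section TableIso.
Variables (K : fieldType) (J : nalgType K) (n : nat).

Lemma table_mul_morph (t : table K n) (f : {linear 'rV[K]_n -> J}) :
  (forall i j, f (table_entry t i j) = f (delta_mx 0 i) ∘ f (delta_mx 0 j)) ->
  forall x y, f (table_mul t x y) = f x ∘ f y.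
Proof.
move=> fE x y.
have fS v : f v = \sum_i v 0 i *: f (delta_mx 0 i).
  by rewrite {1}[v]row_sum_delta linear_sum; apply: eq_bigr => i _; rewrite linearZ.
rewrite (fS x) (fS y) linear_sumlz /table_mul (linear_sum f).
apply: eq_bigr => i _; rewrite linear_sumr (linear_sum f); apply: eq_bigr => j _.
by rewrite linearZ linearZl_LR linearZr_LR /= scalerA fE.
Qed.

End TableIso.

Section TriIso.
Variables (K : fieldType) (J : nalgType K).

(** Four vectors spanning a space of dimension 4 form a basis: the map from coordinates to
    combinations is onto by [span], hence injective by rank-nullity. Multiplicativity is then tested
    on basis vectors. *)
Lemma nalg_iso_tri (e0 e1 e2 e3 : J) p p' p'' q q' r r' s t u :
  \dim (fullv : {vspace J}) = 4%N -> (forall x y : J, x ∘ y = y ∘ x) ->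
  (forall x, exists x0 x1 x2 x3, x = x0 *: e0 + x1 *: e1 + x2 *: e2 + x3 *: e3) ->
  e0 ∘ e0 = p *: e1 + p' *: e2 + p'' *: e3 -> e0 ∘ e1 = q *: e2 + q' *: e3 ->
  e1 ∘ e1 = r *: e2 + r' *: e3 -> e0 ∘ e2 = s *: e3 -> e1 ∘ e2 = t *: e3 ->
  e2 ∘ e2 = u *: e3 -> e3 ∘ e0 = 0 -> e3 ∘ e1 = 0 -> e3 ∘ e2 = 0 -> e3 ∘ e3 = 0 ->
  nalg_iso J (tri_alg [:: p; p'; p''; q; q'; r; r'; s; t; u]).
Proof.
move=> dimJ mulC span e00 e01 e11 e02 e12 e22 e30 e31 e32 e33.
pose f (v : 'rV[K]_4) : J := v 0 (inord 0) *: e0 + v 0 (inord 1) *: e1 +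
  v 0 (inord 2) *: e2 + v 0 (inord 3) *: e3.
have fE x0 x1 x2 x3 : f (row4 x0 x1 x2 x3) = x0 *: e0 + x1 *: e1 + x2 *: e2 + x3 *: e3.
  by rewrite /f !row4E.
have fL : linear f.
  move=> k v w; rewrite /f !mxE !scalerDl !scalerDr !scalerA.
  by rewrite [RHS]addrACA [X in _ = X + _]addrACA [X in _ = X + _ + _]addrACA.
pose fl := GRing.isLinear.Build _ _ _ _ f fL.
pose f' : {linear 'rV[K]_4 -> J} := HB.pack f fl.
pose F := linfun f'.
have fullF : limg F = fullv.
  apply/vspaceP=> x; rewrite memvf; have [x0 [x1 [x2 [x3 ->]]]] := span x.
  by rewrite -fE -[f _]/(f' _) -lfunE memv_img ?memvf.
have kerF : lker F == 0%VS.
  rewrite -dimv_eq0; have := limg_ker_dim F fullv.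
  by rewrite capfv fullF dimJ dimvf /dim /= => /eqP; rewrite (eqn_add2r 4 _ 0).
apply: nalg_iso_sym; exists f'.
  exists (F^-1)%VF => x; rewrite -[f' _](lfunE f') -/F; first exact: lker0_lfunK.
  by rewrite limg_lfunVK // fullF memvf.
move=> x y /=; apply: (@table_mul_morph _ _ _ _ f') => i j.
rewrite -table_mul_delta /=.
have -> : i = inord i by rewrite inord_val.
have -> : j = inord j by rewrite inord_val.
case: i j => [[|[|[|[|//]]]] lti] [[|[|[|[|//]]]] ltj]; rewrite !delta_row4 tri_mulE /= !fE.
all: rewrite ?(mul0r, mulr0, mul1r, mulr1, scale0r, scale1r, addr0, add0r).
all: pose prodE := (e00, e01, e02, e11, e12, e22, e30, e31, e32, e33).
all: by rewrite ?prodE // mulC ?prodE.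
Qed.

Lemma nilpotent_nalg_iso_tri : is_nilpotent J -> (forall x y : J, x ∘ y = y ∘ x) ->
  \dim (fullv : {vspace J}) = 4%N ->
  exists p p' p'' q q' r r' s t u,
    nalg_iso J (tri_alg [:: p; p'; p''; q; q'; r; r'; s; t; u]).
Proof.
move=> nilJ mulC dimJ.
(* This extends [flag_step] to [U = 0], with [e] and [W] equal to 0, so that four iterations are
   possible unconditionally; the truncated predecessor remains a valid bound on the dimension. *)
have step (U : {vspace J}) : (nalg_prod U fullv <= U)%VS -> exists e W,
    [/\ (nalg_prod W fullv <= W)%VS, forall u y, u \in U -> u ∘ y \in W,
      e \in U, (\dim W <= (\dim U).-1)%N &
      forall x, x \in U -> exists k w, w \in W /\ x = k *: e + w].
  move=> sU; have [U0|U0] := eqVneq U 0%VS.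
    rewrite U0 in sU *; exists 0, 0%VS; split; rewrite ?mem0v ?dimv0 //.
      by move=> u y; rewrite memv0 => /eqP->; rewrite linear0l mem0v.
    by move=> x Ux; exists 0, x; rewrite scale0r add0r.
  have [e [W [/andP[sUW sWU] Ue dW genU]]] := flag_step nilJ U0 sU.
  exists e, W; split=> //.
  - exact: subv_trans (nalg_prodS _ sWU) sUW.
  - by move=> u y Uu; move/nalg_prodP: sUW; apply; rewrite ?memvf.
  - by rewrite -ltnS prednK // (leq_trans _ dW).
  - by move=> x /genU[k Wx]; exists k, (x - k *: e); rewrite subrKC.
have [e0 [W1 [sW1 m1 _ d1 g1]]] := step _ (subvf _).
have [e1 [W2 [sW2 m2 W1e1 d2 g2]]] := step _ sW1.
have [e2 [W3 [sW3 m3 W2e2 d3 g3]]] := step _ sW2.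
have [e3 [W4 [_ m4 W3e3 d4 g4]]] := step _ sW3.
have {d1 d2 d3 d4} W40 x : x \in W4 -> x = 0.
  suff -> : W4 = 0%VS by rewrite memv0 => /eqP.
  apply/eqP; rewrite -dimv_eq0 -leqn0; move: d1 d2 d3 d4; rewrite dimJ; lia.
have {}g4 x : x \in W3 -> exists k, x = k *: e3.
  by move=> /g4[k [w [/W40-> ->]]]; exists k; rewrite addr0.
have {}g3 x : x \in W2 -> exists k l, x = k *: e2 + l *: e3.
  by move=> /g3[k [w [/g4[l ->] ->]]]; exists k, l.
have {}g2 x : x \in W1 -> exists k l m, x = k *: e1 + l *: e2 + m *: e3.
  by move=> /g2[k [w [/g3[l [m ->]] ->]]]; exists k, l, m; rewrite addrA.
have {}g1 x : exists k l m h, x = k *: e0 + l *: e1 + m *: e2 + h *: e3.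
  have [k [w [/g2[l [m [h ->]]] ->]]] := g1 x (memvf x).
  by exists k, l, m, h; rewrite !addrA.
have [p [p' [p'' e00]]] := g2 _ (m1 e0 e0 (memvf _)).
have [q [q' e10]] := g3 _ (m2 e1 e0 W1e1).
have [r [r' e11]] := g3 _ (m2 e1 e1 W1e1).
have [s e20] := g4 _ (m3 e2 e0 W2e2); have [t e21] := g4 _ (m3 e2 e1 W2e2).
have [u e22] := g4 _ (m3 e2 e2 W2e2).
exists p, p', p'', q, q', r, r', s, t, u.
apply: nalg_iso_tri g1 e00 _ e11 _ _ e22 _ _ _ _ => //;
  by [apply/W40/m4 | rewrite mulC].
Qed.

End TriIso.

(** * Classification of the structure constants *)

Section ChangeOfBasis.
Variable K : fieldType.
Implicit Types (x y : K) (v f g : 'rV[K]_4) (p q : seq K).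

Definition comb4 f0 f1 f2 f3 v : 'rV[K]_4 :=
  v 0 (inord 0) *: f0 + v 0 (inord 1) *: f1 + v 0 (inord 2) *: f2 + v 0 (inord 3) *: f3.

Lemma comb4E f0 f1 f2 f3 x0 x1 x2 x3 :
  comb4 f0 f1 f2 f3 (row4 x0 x1 x2 x3) = x0 *: f0 + x1 *: f1 + x2 *: f2 + x3 *: f3.
Proof. by rewrite /comb4 !row4E. Qed.

(* [f0, ..., f3] is a basis of [tri_alg q] with multiplication table [p], and [g_i] are
   the coordinates of the i-th standard vector in it, which witnesses freeness. *)
Lemma tri_iso_comb4 p q f0 f1 f2 f3 g0 g1 g2 g3 :
  (forall x0 x1 x2 x3 y0 y1 y2 y3,
    comb4 f0 f1 f2 f3
      (table_mul (tri p) (row4 x0 x1 x2 x3) (row4 y0 y1 y2 y3)) =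
    table_mul (tri q) (comb4 f0 f1 f2 f3 (row4 x0 x1 x2 x3))
      (comb4 f0 f1 f2 f3 (row4 y0 y1 y2 y3))) ->
  comb4 f0 f1 f2 f3 g0 = row4 1 0 0 0 -> comb4 f0 f1 f2 f3 g1 = row4 0 1 0 0 ->
  comb4 f0 f1 f2 f3 g2 = row4 0 0 1 0 -> comb4 f0 f1 f2 f3 g3 = row4 0 0 0 1 ->
  nalg_iso (tri_alg p) (tri_alg q).
Proof.
move=> fM fg0 fg1 fg2 fg3.
pose F := \matrix_(i < 4, j < 4) nth 0 [:: f0; f1; f2; f3] i 0 j.
pose G := \matrix_(i < 4, j < 4) nth 0 [:: g0; g1; g2; g3] i 0 j.
have FE v : v *m F = comb4 f0 f1 f2 f3 v.
  have [x0 [x1 [x2 [x3 ->]]]] := row4P v; apply/rowP=> j.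
  by rewrite comb4E !mxE !big_ord_recl big_ord0 !mxE /= addr0 !addrA.
have GF : G *m F = 1%:M.
  apply/row_matrixP=> i; rewrite row_mul.
  have -> : row i G = nth 0 [:: g0; g1; g2; g3] i.
    by apply/rowP=> j; rewrite !mxE.
  rewrite FE; have -> : row i 1%:M = nth 0 [:: row4 1 0 0 0; row4 0 1 0 0;
      row4 0 0 1 0; row4 0 0 0 1] i :> 'rV[K]_4.
    case: i => [[|[|[|[|//]]]] lti]; apply/rowP=> -[[|[|[|[|//]]]] ltj];
      by rewrite !mxE.
  by case: i => [[|[|[|[|//]]]] lti].
exists (mulmxr F).
  exists (mulmxr G) => v /=; rewrite -mulmxA ?GF ?mulmx1 //.
  by rewrite (mulmx1C GF) mulmx1.
move=> v w /=; have [x0 [x1 [x2 [x3 ->]]]] := row4P v.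
by have [y0 [y1 [y2 [y3 ->]]]] := row4P w; rewrite !FE fM.
Qed.

End ChangeOfBasis.

Section Classification.
Variable R : rcfType.
Implicit Types (p q r s t u x k : R).
Local Notation row := (@row4 R).

Definition classified (p : seq R) := exists i, nalg_iso (tri_alg p) (J4 R i).

Lemma classified_par i : (i < 17)%N -> classified (nth [::] (J4_pars R) i).
Proof. by move=> lti; exists (Ordinal lti); apply/nalg_iso_sym/J4_iso_tri. Qed.

Lemma classified_change (p q : seq R) f0 f1 f2 f3 g0 g1 g2 g3 :
  (forall x0 x1 x2 x3 y0 y1 y2 y3,
    comb4 f0 f1 f2 f3
      (table_mul (tri p) (row4 x0 x1 x2 x3) (row4 y0 y1 y2 y3)) =
    table_mul (tri q) (comb4 f0 f1 f2 f3 (row4 x0 x1 x2 x3))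
      (comb4 f0 f1 f2 f3 (row4 y0 y1 y2 y3))) ->
  comb4 f0 f1 f2 f3 g0 = row4 1 0 0 0 -> comb4 f0 f1 f2 f3 g1 = row4 0 1 0 0 ->
  comb4 f0 f1 f2 f3 g2 = row4 0 0 1 0 -> comb4 f0 f1 f2 f3 g3 = row4 0 0 0 1 ->
  classified p -> classified q.
Proof.
move=> fM fg0 fg1 fg2 fg3 [i piso]; exists i.
apply: nalg_iso_trans piso.
by apply/nalg_iso_sym/(tri_iso_comb4 fM fg0 fg1 fg2 fg3).
Qed.

Ltac rowfield :=
  repeat match goal with x := _ |- _ => subst x end;
  rewrite ?tri_mulE ?comb4E ?row4Z ?row4D ?tri_mulE ?comb4E ?row4Z ?row4D /=;
  congr row4; first [done | by field
    | field; rewrite ?mulf_eq0 ?expf_eq0 //=; do ?[apply/andP; split=> //=]].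
(** The [f]s are a new basis in the old coordinates, the [g]s the old basis in the new ones, and [p]
    is the table in the new basis; the goal becomes [classified p]. *)
Ltac newbasis p f0 f1 f2 f3 g0 g1 g2 g3 :=
  apply: (@classified_change p _ f0 f1 f2 f3 g0 g1 g2 g3);
  [by move=> *; rowfield | by rowfield | by rowfield | by rowfield | by rowfield | ].
Ltac samebasis p :=
  newbasis p (row 1 0 0 0) (row 0 1 0 0) (row 0 0 1 0) (row 0 0 0 1)
    (row 1 0 0 0) (row 0 1 0 0) (row 0 0 1 0) (row 0 0 0 1).

(** Rescaling by [k] normalises a coefficient up to sign, which is where the pairs with [alpha]
    equal to 1 and -1 come from. Square roots are taken nowhere else. *)
Lemma sign_square (x : R) : x != 0 ->
  exists2 k, k != 0 & x = k ^+ 2 \/ x = - k ^+ 2.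
Proof.
move=> x0; exists (Num.sqrt `|x|).
  by rewrite gt_eqF // sqrtr_gt0 normr_gt0.
rewrite sqr_sqrtr ?normr_ge0 //; case: (ger0P x) => _; [by left | right].
by rewrite opprK.
Qed.

(* [l] makes e0' ∘ e1 vanish, [m] makes e2' a null vector and [r] makes e0' ∘ e2' vanish. *)
Lemma classified_square_pivot q s t u : t != 0 ->
  classified [:: 1; 0; 0; 0; q; 0; 0; s; t; u].
Proof.
move=> t0; pose l := - q / t; pose k := 2 * l * s + l ^+ 2 * u.
pose m := - u / (2 * t); pose r := - (s + l * u) / t.
newbasis [:: 1:R; 0; 0; 0; 0; 0; 0; 0; 1]
  (row 1 r l 0) (row 0 1 0 k) (row 0 m 1 0) (row 0 0 0 t)
  (row 1 (l * m - r) (- l) ((r - l * m) * k / t)) (row 0 1 0 (- k / t))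
  (row 0 (- m) 1 (m * k / t)) (row 0 0 0 t^-1).
exact: (@classified_par 7).
Qed.

(** For [u = 0] the vector e2 spans a central component and the algebra is [J4_4]; otherwise it is
    [J4_7]. *)
Lemma classified_double_cube q u : q != 0 -> classified [:: 1; 0; 0; 0; q; 0; 0; 0; 0; u].
Proof.
move=> q0; have [->|u0] := eqVneq u 0.
  newbasis [:: 1:R; 0; 0; 1]
    (row 1 0 0 0) (row 0 1 0 0) (row 0 0 0 q) (row 0 0 1 0)
    (row 1 0 0 0) (row 0 1 0 0) (row 0 0 0 1) (row 0 0 q^-1 0).
  exact: (@classified_par 4).
(* With e0 and e2 both scaled by u / q, the cube of e0 and the square of e2 become equal
   without a cube root. *)
newbasis [:: 1:R; 0; 0; 0; 1; 0; 0; 0; 0; 1]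
  (row (u / q) 0 0 0) (row 0 ((u / q) ^+ 2) 0 0) (row 0 0 (u / q) 0)
  (row 0 0 0 (u ^+ 3 / q ^+ 2))
  (row (q / u) 0 0 0) (row 0 ((q / u) ^+ 2) 0 0) (row 0 0 (q / u) 0)
  (row 0 0 0 (q ^+ 2 / u ^+ 3)).
exact: (@classified_par 8).
Qed.

(* All products lie on the line of e3: J is a quadratic form in three variables up to
   scaling. *)
Lemma classified_diagonal_form p r u :
  classified [:: 0; 0; p; 0; 0; 0; r; 0; 0; u].
Proof.
(* The two [wlog]s permute e0, e1, e2 so that nonzero squares come first; the rank of the form is
   then the position of the last one. *)
wlog p0 : p r u / p != 0 => [wl|].
  have [p0|] := eqVneq p 0; last exact: wl.
  have [r0|r0] := eqVneq r 0; last first.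
    newbasis [:: 0; 0; r; 0; 0; 0; p; 0; 0; u]
      (row 0 1 0 0) (row 1 0 0 0) (row 0 0 1 0) (row 0 0 0 1)
      (row 0 1 0 0) (row 1 0 0 0) (row 0 0 1 0) (row 0 0 0 1).
    exact: wl.
  have [u0|u0] := eqVneq u 0; last first.
    newbasis [:: 0; 0; u; 0; 0; 0; r; 0; 0; p]
      (row 0 0 1 0) (row 0 1 0 0) (row 1 0 0 0) (row 0 0 0 1)
      (row 0 0 1 0) (row 0 1 0 0) (row 1 0 0 0) (row 0 0 0 1).
    exact: wl.
  rewrite p0 r0 u0; samebasis ([::] : seq R).
  exact: (@classified_par 0).
wlog r0 : r u / (r != 0) || (u == 0) => [wl|].
  have [r0|r0] := eqVneq r 0; last by apply: wl; rewrite r0.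
  newbasis [:: 0; 0; p; 0; 0; 0; u; 0; 0; r]
    (row 1 0 0 0) (row 0 0 1 0) (row 0 1 0 0) (row 0 0 0 1)
    (row 1 0 0 0) (row 0 0 1 0) (row 0 1 0 0) (row 0 0 0 1).
  by apply: wl; rewrite r0 eqxx orbT.
have [rE|r1] := eqVneq r 0.
  rewrite rE eqxx /= in r0; rewrite rE (eqP r0).
  newbasis [:: 1:R]
    (row 1 0 0 0) (row 0 0 0 p) (row 0 1 0 0) (row 0 0 1 0)
    (row 1 0 0 0) (row 0 0 1 0) (row 0 0 0 1) (row 0 p^-1 0 0).
  exact: (@classified_par 1).
have {r0 r1}[k k0 rk] : exists2 k, k != 0 & r = p * k ^+ 2 \/ r = - p * k ^+ 2.
  have [|k k0 rp] := @sign_square (r / p); first by rewrite mulf_neq0 ?invr_eq0.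
  exists k => //; case: rp => rp; [left | right]; move: rp => /(canRL (divfK p0)) ->;
    ring.
have [->|u0] := eqVneq u 0.
  case: rk => ->.
    newbasis [:: 0:R; 1; 0; 0; 0; 1]
      (row 1 0 0 0) (row 0 k^-1 0 0) (row 0 0 0 p) (row 0 0 1 0)
      (row 1 0 0 0) (row 0 k 0 0) (row 0 0 0 1) (row 0 0 p^-1 0).
    exact: (@classified_par 2).
  newbasis [:: 0:R; 1; 0; 0; 0; -1]
    (row 1 0 0 0) (row 0 k^-1 0 0) (row 0 0 0 p) (row 0 0 1 0)
    (row 1 0 0 0) (row 0 k 0 0) (row 0 0 0 1) (row 0 0 p^-1 0).
  exact: (@classified_par 3).
have {u0}[l l0 ul] : exists2 l, l != 0 & u = p * l ^+ 2 \/ u = - p * l ^+ 2.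
  have [|l l0 up] := @sign_square (u / p); first by rewrite mulf_neq0 ?invr_eq0.
  exists l => //; case: up => up; [left | right]; move: up => /(canRL (divfK p0)) ->;
    ring.
have [clP clN] : classified [:: 0; 0; 1; 0; 0; 0; 1; 0; 0; 1] /\
    classified [:: 0; 0; 1; 0; 0; 0; 1; 0; 0; -1].
  by split; [exact: (@classified_par 5) | exact: (@classified_par 6)].
(* After division by [p] the signatures are (3,0), (2,1), (2,1), (1,2). A change of sign of the last
   basis vector turns (1,2) into (2,1), so rank 3 yields two algebras. *)
case: rk => ->; case: ul => ->.
- newbasis [:: 0:R; 0; 1; 0; 0; 0; 1; 0; 0; 1]
    (row 1 0 0 0) (row 0 k^-1 0 0) (row 0 0 l^-1 0) (row 0 0 0 p)
    (row 1 0 0 0) (row 0 k 0 0) (row 0 0 l 0) (row 0 0 0 p^-1).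
  exact: clP.
- newbasis [:: 0:R; 0; 1; 0; 0; 0; 1; 0; 0; -1]
    (row 1 0 0 0) (row 0 k^-1 0 0) (row 0 0 l^-1 0) (row 0 0 0 p)
    (row 1 0 0 0) (row 0 k 0 0) (row 0 0 l 0) (row 0 0 0 p^-1).
  exact: clN.
- newbasis [:: 0:R; 0; 1; 0; 0; 0; 1; 0; 0; -1]
    (row 1 0 0 0) (row 0 0 l^-1 0) (row 0 k^-1 0 0) (row 0 0 0 p)
    (row 1 0 0 0) (row 0 0 k 0) (row 0 l 0 0) (row 0 0 0 p^-1).
  exact: clN.
- newbasis [:: 0:R; 0; 1; 0; 0; 0; 1; 0; 0; -1]
    (row 0 0 l^-1 0) (row 0 k^-1 0 0) (row 1 0 0 0) (row 0 0 0 (- p))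
    (row 0 0 1 0) (row 0 k 0 0) (row l 0 0 0) (row 0 0 0 (- p^-1)).
  exact: clN.
Qed.

(** Since e0 is orthogonal to e1 and e2, it remains to diagonalise their block, by completing the
    square with [r] or [u] as pivot. *)
Lemma classified_block_form p r t u :
  classified [:: 0; 0; p; 0; 0; 0; r; 0; t; u].
Proof.
have [r0|r0] := eqVneq r 0; last first.
  newbasis [:: 0; 0; p; 0; 0; 0; r; 0; 0; u - t ^+ 2 / r]
    (row 1 0 0 0) (row 0 1 0 0) (row 0 (- t / r) 1 0) (row 0 0 0 1)
    (row 1 0 0 0) (row 0 1 0 0) (row 0 (t / r) 1 0) (row 0 0 0 1).
  exact: classified_diagonal_form.
have [u0|u0] := eqVneq u 0; last first.
  newbasis [:: 0; 0; p; 0; 0; 0; r - t ^+ 2 / u; 0; 0; u]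
    (row 1 0 0 0) (row 0 1 (- t / u) 0) (row 0 0 1 0) (row 0 0 0 1)
    (row 1 0 0 0) (row 0 1 (t / u) 0) (row 0 0 1 0) (row 0 0 0 1).
  exact: classified_diagonal_form.
(* Without a pivot, e1 + e2/2 and e1 - e2/2 are orthogonal and have squares t e3 and -t e3. *)
rewrite r0 u0; newbasis [:: 0; 0; p; 0; 0; 0; t; 0; 0; - t]
  (row 1 0 0 0) (row 0 1 (1/2) 0) (row 0 1 (-1/2) 0) (row 0 0 0 1)
  (row 1 0 0 0) (row 0 (1/2) (1/2) 0) (row 0 1 (-1) 0) (row 0 0 0 1).
exact: classified_diagonal_form.
Qed.

(** Gaussian reduction: a vector of nonzero square is moved to the front and split off. If e0 is
    isotropic but has a nonzero product with another isotropic basis vector, their sum serves as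
    pivot; if it is orthogonal to e1 and e2, it splits off already. *)
Lemma classified_form p q r s t u :
  classified [:: 0; 0; p; 0; q; 0; r; s; t; u].
Proof.
wlog p0 : p q r s t u / (p != 0) || (q == 0) && (s == 0) => [wl|].
  have [p0|p0] := eqVneq p 0; last by apply: wl; rewrite p0.
  have [r0|r0] := eqVneq r 0; last first.
    newbasis [:: 0; 0; r; 0; q; 0; p; t; s; u]
      (row 0 1 0 0) (row 1 0 0 0) (row 0 0 1 0) (row 0 0 0 1)
      (row 0 1 0 0) (row 1 0 0 0) (row 0 0 1 0) (row 0 0 0 1).
    by apply: wl; rewrite r0.
  have [q0|q0] := eqVneq q 0; last first.
    newbasis [:: 0; 0; p + 2 * q + r; 0; q + r; 0; r; s + t; t; u]
      (row 1 1 0 0) (row 0 1 0 0) (row 0 0 1 0) (row 0 0 0 1)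
      (row 1 (-1) 0 0) (row 0 1 0 0) (row 0 0 1 0) (row 0 0 0 1).
    by apply: wl; rewrite p0 r0 addr0 add0r mulf_neq0 ?pnatr_eq0.
  have [u0|u0] := eqVneq u 0; last first.
    newbasis [:: 0; 0; u; 0; t; 0; r; s; q; p]
      (row 0 0 1 0) (row 0 1 0 0) (row 1 0 0 0) (row 0 0 0 1)
      (row 0 0 1 0) (row 0 1 0 0) (row 1 0 0 0) (row 0 0 0 1).
    by apply: wl; rewrite u0.
  have [s0|s0] := eqVneq s 0; first by apply: wl; rewrite q0 s0 !eqxx orbT.
  newbasis [:: 0; 0; p + 2 * s + u; 0; q + t; 0; r; s + u; t; u]
    (row 1 0 1 0) (row 0 1 0 0) (row 0 0 1 0) (row 0 0 0 1)
    (row 1 0 (-1) 0) (row 0 1 0 0) (row 0 0 1 0) (row 0 0 0 1).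
  by apply: wl; rewrite p0 u0 addr0 add0r mulf_neq0 ?pnatr_eq0.
case/orP: p0 => [p0|/andP[/eqP-> /eqP->]]; last exact: classified_block_form.
newbasis [:: 0; 0; p; 0; 0; 0; r - q ^+ 2 / p; 0; t - q * s / p; u - s ^+ 2 / p]
  (row 1 0 0 0) (row (- q / p) 1 0 0) (row (- s / p) 0 1 0) (row 0 0 0 1)
  (row 1 0 0 0) (row (q / p) 1 0 0) (row (s / p) 0 1 0) (row 0 0 0 1).
exact: classified_block_form.
Qed.

(* Here J is a pencil of binary quadratic forms: the e2- and e3-coordinates of x^2. *)
Lemma classified_pencil_normal r : classified [:: 0; 1; 0; 0; 1; r].
Proof.
have [->|/sign_square[k k0 rk]] := eqVneq r 0.
  samebasis [:: 0:R; 1; 0; 0; 1].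
  exact: (@classified_par 14).
case: rk => ->.
  newbasis [:: 0:R; 1; 0; 0; 1; 1]
   (row 1 0 0 0) (row 0 k^-1 0 0) (row 0 0 1 0) (row 0 0 0 k^-1)
   (row 1 0 0 0) (row 0 k 0 0) (row 0 0 1 0) (row 0 0 0 k).
  exact: (@classified_par 15).
newbasis [:: 0:R; 1; 0; 0; 1; -1]
   (row 1 0 0 0) (row 0 k^-1 0 0) (row 0 0 1 0) (row 0 0 0 k^-1)
   (row 1 0 0 0) (row 0 k 0 0) (row 0 0 1 0) (row 0 0 0 k).
exact: (@classified_par 16).
Qed.

Lemma classified_pencil_orthogonal q r r' : classified [:: 0; 1; 0; 0; q; r; r'].
Proof.
have [->|q0] := eqVneq q 0; last first.
  (* With this [h] the square of e1 + h e0 has no e3-coordinate; the product of e0 with this vector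
     becomes the new e3. *)
  pose h := - r' / (2 * q).
  newbasis [:: 0; 1; 0; 0; 1; r + h ^+ 2]
    (row 1 0 0 0) (row h 1 0 0) (row 0 0 1 0) (row 0 0 h q)
    (row 1 0 0 0) (row (- h) 1 0 0) (row 0 0 1 0) (row 0 0 (- h / q) q^-1).
  exact: classified_pencil_normal.
have [->|r0] := eqVneq r' 0; last first.
  newbasis [:: 0:R; 1; 0; 0; 0; 0; 1]
    (row 1 0 0 0) (row 0 1 0 0) (row 0 0 1 0) (row 0 0 r r')
    (row 1 0 0 0) (row 0 1 0 0) (row 0 0 1 0) (row 0 0 (- r / r') r'^-1).
  (* When e0^2 = e2, e1^2 = e3 and e0 ∘ e1 = 0, the vectors e0 + e1 and e0 - e1 have the same square
     e2 + e3 and product e2 - e3. *)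
  newbasis [:: 0:R; 1; 0; 0; 1; 1]
    (row 1 1 0 0) (row 1 (-1) 0 0) (row 0 0 1 1) (row 0 0 1 (-1))
    (row (1/2) (1/2) 0 0) (row (1/2) (-1/2) 0 0) (row 0 0 (1/2) (1/2)) (row 0 0 (1/2) (-1/2)).
  exact: classified_pencil_normal.
have [->|/sign_square[k k0 rk]] := eqVneq r 0.
  newbasis [:: 1:R]
    (row 1 0 0 0) (row 0 0 1 0) (row 0 1 0 0) (row 0 0 0 1)
    (row 1 0 0 0) (row 0 0 1 0) (row 0 1 0 0) (row 0 0 0 1).
  exact: (@classified_par 1).
case: rk => ->.
  newbasis [:: 0:R; 1; 0; 0; 0; 1]
   (row 1 0 0 0) (row 0 k^-1 0 0) (row 0 0 1 0) (row 0 0 0 1)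
   (row 1 0 0 0) (row 0 k 0 0) (row 0 0 1 0) (row 0 0 0 1).
  exact: (@classified_par 2).
newbasis [:: 0:R; 1; 0; 0; 0; -1]
   (row 1 0 0 0) (row 0 k^-1 0 0) (row 0 0 1 0) (row 0 0 0 1)
   (row 1 0 0 0) (row 0 k 0 0) (row 0 0 1 0) (row 0 0 0 1).
exact: (@classified_par 3).
Qed.

(** The pivoting of [classified_form] is applied to the e2-coordinate. A pivot e0 allows e0^2 as the
    new e2 and makes e1 orthogonal to e0 for that coordinate; without one, all products lie on the
    line of e3. *)
Lemma classified_pencil p p' q q' r r' :
  classified [:: 0; p; p'; q; q'; r; r'; 0; 0; 0].
Proof.
wlog p0 : p p' q q' r r' / (p != 0) || (q == 0) && (r == 0) => [wl|].
  have [p0|p0] := eqVneq p 0; last by apply: wl; rewrite p0.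
  have [r0|r0] := eqVneq r 0; last first.
    newbasis [:: 0; r; r'; q; q'; p; p'; 0; 0; 0]
      (row 0 1 0 0) (row 1 0 0 0) (row 0 0 1 0) (row 0 0 0 1)
      (row 0 1 0 0) (row 1 0 0 0) (row 0 0 1 0) (row 0 0 0 1).
    by apply: wl; rewrite r0.
  have [q0|q0] := eqVneq q 0; first by apply: wl; rewrite q0 r0 !eqxx orbT.
  newbasis [:: 0; p + 2 * q + r; p' + 2 * q' + r'; q + r; q' + r'; r; r'; 0; 0; 0]
    (row 1 1 0 0) (row 0 1 0 0) (row 0 0 1 0) (row 0 0 0 1)
    (row 1 (-1) 0 0) (row 0 1 0 0) (row 0 0 1 0) (row 0 0 0 1).
  by apply: wl; rewrite p0 r0 addr0 add0r mulf_neq0 ?pnatr_eq0.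
have [pE|{}p0] := eqVneq p 0.
  move: p0; rewrite pE eqxx /= => /andP[/eqP-> /eqP->].
  exact: classified_form.
newbasis [:: 0; 1; 0; 0; q' - q * p' / p; (r - q ^+ 2 / p) / p;
    r' - 2 * q * q' / p + q ^+ 2 * p' / p ^+ 2 - (r - q ^+ 2 / p) / p * p']
  (row 1 0 0 0) (row (- q / p) 1 0 0) (row 0 0 p p') (row 0 0 0 1)
  (row 1 0 0 0) (row (q / p) 1 0 0) (row 0 0 p^-1 (- p' / p)) (row 0 0 0 1).
exact: classified_pencil_orthogonal.
Qed.

(** If [t] and [q] vanish, e1 annihilates everything and an exchange of e1 and e2 gives a pencil. If
    only [t] vanishes, a multiple of e1 added to e2 removes [s]. *)
Lemma classified_square_step q s t u : classified [:: 1; 0; 0; 0; q; 0; 0; s; t; u].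
Proof.
have [->|t0] := eqVneq t 0; last exact: classified_square_pivot.
have [->|q0] := eqVneq q 0.
  newbasis [:: 0; 1; 0; 0; s; 0; u]
    (row 1 0 0 0) (row 0 0 1 0) (row 0 1 0 0) (row 0 0 0 1)
    (row 1 0 0 0) (row 0 0 1 0) (row 0 1 0 0) (row 0 0 0 1).
  exact: classified_pencil_orthogonal.
newbasis [:: 1; 0; 0; 0; q; 0; 0; 0; 0; u]
    (row 1 0 0 0) (row 0 1 0 0) (row 0 (- s / q) 1 0) (row 0 0 0 1)
    (row 1 0 0 0) (row 0 1 0 0) (row 0 (s / q) 1 0) (row 0 0 0 1).
exact: classified_double_cube.
Qed.

(* From here on x ∘ e2 = l(x) e3 with a linear form l that is nonzero and normalised to
   the first coordinate.  The algebra is governed by the restriction to ker l of the form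
   given by the e2-coordinate of x^2. *)
Lemma classified_cubic_shift p p' q q' r r' :
  classified [:: 0; p; 0; q; 0; r; r'; 1] ->
  classified [:: 0; p; p'; q; q'; r; r'; 1; 0; 0].
Proof.
(* As e0 ∘ e2 = e3, multiples of e2 added to e0 and e1 absorb the e3-coordinates [p'] and [q']. *)
move=> cl; newbasis [:: 0; p; 0; q; 0; r; r'; 1]
    (row 1 0 (- p' / 2) 0) (row 0 1 (- q') 0) (row 0 0 1 0) (row 0 0 0 1)
    (row 1 0 (p' / 2) 0) (row 0 1 q' 0) (row 0 0 1 0) (row 0 0 0 1).
exact: cl.
Qed.

(** The form is nonzero on ker l. Its value [p] at e0 decides: [J4_6] for 0, and otherwise [J4_8]
    with the sign of [p]. *)
Lemma classified_cubic_anisotropic p : classified [:: 0; p; 0; 0; 0; 1; 0; 1].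
Proof.
have [->|p0] := eqVneq p 0.
  newbasis [:: 1:R; 0; 0; 0; 0; 0; 0; 0; 1]
    (row 0 1 0 0) (row 0 0 1 0) (row 1 0 0 0) (row 0 0 0 1)
    (row 0 0 1 0) (row 1 0 0 0) (row 0 1 0 0) (row 0 0 0 1).
  exact: (@classified_par 7).
have [k k0 pk] := sign_square p0.
case: pk => ->.
  newbasis [:: 0:R; 1; 0; 0; 0; 1; 0; 1]
    (row 1 0 0 0) (row 0 k 0 0) (row 0 0 (k ^+ 2) 0) (row 0 0 0 (k ^+ 2))
    (row 1 0 0 0) (row 0 k^-1 0 0) (row 0 0 (k ^- 2) 0) (row 0 0 0 (k ^- 2)).
  exact: (@classified_par 9).
newbasis [:: 0:R; 1; 0; 0; 0; -1; 0; 1]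
  (row 1 0 0 0) (row 0 k 0 0) (row 0 0 (- k ^+ 2) 0) (row 0 0 0 (- k ^+ 2))
  (row 1 0 0 0) (row 0 k^-1 0 0) (row 0 0 (- k ^- 2) 0) (row 0 0 0 (- k ^- 2)).
exact: (@classified_par 10).
Qed.

(** The form is a hyperbolic plane vanishing on ker l. The e3-coordinate [r] of e1^2 separates
    [J4_9] (zero) from [J4_10] (nonzero). *)
Lemma classified_cubic_isotropic r : classified [:: 0; 0; 0; 1; 0; 0; r; 1].
Proof.
have [->|r0] := eqVneq r 0.
  newbasis [:: 0:R; 1; 0; 0; 0; -1; 0; 1; 1]
    (row (1/2) (1/2) 0 0) (row (1/2) (-1/2) 0 0) (row 0 0 (1/2) 0) (row 0 0 0 (1/4))
    (row 1 1 0 0) (row 1 (-1) 0 0) (row 0 0 2 0) (row 0 0 0 4).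
  exact: (@classified_par 11).
pose h := - (2 * r)^-1.
have h0 : h != 0 by rewrite oppr_eq0 invr_eq0 mulf_neq0 ?pnatr_eq0.
have rE : r = - (2 * h)^-1 by rewrite /h; field.
rewrite {}rE; move: h h0 => {r0} h h0.
newbasis [:: 0:R; 1; 0; 0; 1; -1; 0; 1; 1]
  (row (1/2) (h/2) (h/8) 0) (row (1/2) (-h/2) (h/8) 0) (row 0 0 (h/2) 0) (row 0 0 0 (h/4))
  (row 1 1 (-1/2) 0) (row (h^-1) (-h^-1) 0 0) (row 0 0 (2/h) 0) (row 0 0 0 (4/h)).
exact: (@classified_par 12).
Qed.

Lemma classified_cubic p p' q q' r r' :
  classified [:: 0; p; p'; q; q'; r; r'; 1; 0; 0].
Proof.
apply: classified_cubic_shift.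
(* Modulo e2 and e3, ker l is the line of e1. The cases are: the form is nonzero there ([r]),
   vanishes there but pairs it with e0 ([q]), or has it in its radical. *)
have [->|r0] := eqVneq r 0; last first.
  pose P := (p - q ^+ 2 / r) / r.
  newbasis [:: 0; P; ((q / r) ^+ 2 * r' - P * r') / r; 0; - q * r' / r ^+ 2; 1; 0; 1; 0; 0]
    (row 1 (- q / r) 0 0) (row 0 1 0 0) (row 0 0 r r') (row 0 0 0 r)
    (row 1 (q / r) 0 0) (row 0 1 0 0) (row 0 0 r^-1 (- r' / r ^+ 2)) (row 0 0 0 r^-1).
  by apply: classified_cubic_shift; apply: classified_cubic_anisotropic.
have [->|q0] := eqVneq q 0; last first.
  newbasis [:: 0; 0; (p / (2 * q)) ^+ 2 * r' / q; 1; - (p / (2 * q)) * r' / q; 0; r' / q; 1; 0; 0]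
    (row 1 (- p / (2 * q)) 0 0) (row 0 1 0 0) (row 0 0 q 0) (row 0 0 0 q)
    (row 1 (p / (2 * q)) 0 0) (row 0 1 0 0) (row 0 0 q^-1 0) (row 0 0 0 q^-1).
  by apply: classified_cubic_shift; apply: classified_cubic_isotropic.
have [->|p0] := eqVneq p 0.
  samebasis [:: 0; 0; 0; 0; 0; 0; r'; 1; 0; 0].
  exact: classified_form.
newbasis [:: 1; 0; 0; 0; 1; 0; 0; 0; 0; r' / p]
    (row 1 0 0 0) (row 0 0 p 0) (row 0 1 0 0) (row 0 0 0 p)
    (row 1 0 0 0) (row 0 0 1 0) (row 0 p^-1 0 0) (row 0 0 0 p^-1).
by apply: classified_double_cube; rewrite oner_eq0.
Qed.

(** Here l(x) is s x0 + t x1. If l = 0 the algebra is a pencil; otherwise a change of e0, e1 and a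
    scaling of e3 normalise l to the first coordinate. *)
Lemma classified_square_in_plane p p' q q' r r' s t :
  classified [:: 0; p; p'; q; q'; r; r'; s; t; 0].
Proof.
wlog s0 : p p' q q' r r' s t / (s != 0) || (t == 0) => [wl|].
  have [s0|s0] := eqVneq s 0; last by apply: wl; rewrite s0.
  newbasis [:: 0; r; r'; q; q'; p; p'; t; s; 0]
    (row 0 1 0 0) (row 1 0 0 0) (row 0 0 1 0) (row 0 0 0 1)
    (row 0 1 0 0) (row 1 0 0 0) (row 0 0 1 0) (row 0 0 0 1).
  by apply: wl; rewrite s0 eqxx orbT.
have [sE|{}s0] := eqVneq s 0.
  by move: s0; rewrite sE eqxx => /eqP->; exact: classified_pencil.
newbasis [:: 0; p; p' / s; q - t / s * p; (q' - t / s * p') / s;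
    r - 2 * t / s * q + (t / s) ^+ 2 * p;
    (r' - 2 * t / s * q' + (t / s) ^+ 2 * p') / s; 1; 0; 0]
  (row 1 0 0 0) (row (- t / s) 1 0 0) (row 0 0 1 0) (row 0 0 0 s)
  (row 1 0 0 0) (row (t / s) 1 0 0) (row 0 0 1 0) (row 0 0 0 s^-1).
exact: classified_cubic.
Qed.

(** The hypothesis is the outcome of the Jordan identity in [tri_jordan_cond]. If [p != 0], the
    square of e0 replaces e1 in the basis, and the last equation gives the square of that new
    vector. *)
Lemma classified_tri p p' p'' q q' r r' s t u :
  (if p == 0 then u = 0 \/ [/\ p' = 0, q = 0 & r = 0]
  else [/\ r = 0, q * u = 0, q * t = 0 &
           p ^+ 2 * r' + 2 * p * p' * t + p' ^+ 2 * u = q * p * s]) ->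
  classified [:: p; p'; p''; q; q'; r; r'; s; t; u].
Proof.
have [->|p0] := eqVneq p 0.
  by case=> [->|[-> -> ->]]; [exact: classified_square_in_plane | exact: classified_form].
case=> -> qu qt rE.
have [q0|q0] := eqVneq q 0.
  have -> : r' = - (2 * p * p' * t + p' ^+ 2 * u) / p ^+ 2.
    apply: (mulfI (expf_neq0 2 p0)); rewrite mulrCA divff ?expf_neq0 // mulr1.
    apply/eqP; rewrite -addr_eq0; apply/eqP.
    rewrite -[RHS](mul0r (p * s)) -q0 mulrA -rE; ring.
  rewrite q0; newbasis [:: 1; 0; 0; 0; p * q' + p' * s; 0; 0; s; p * t + p' * u; u]
    (row 1 0 0 0) (row 0 p p' p'') (row 0 0 1 0) (row 0 0 0 1)
    (row 1 0 0 0) (row 0 p^-1 (- p' / p) (- p'' / p)) (row 0 0 1 0) (row 0 0 0 1).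
  exact: classified_square_step.
have u0 : u = 0 by apply: (mulfI q0); rewrite mulr0.
have t0 : t = 0 by apply: (mulfI q0); rewrite mulr0.
have {rE}-> : r' = q * s / p.
  by apply: (mulfI (expf_neq0 2 p0)); move: rE; rewrite u0 t0 !mulr0 !addr0 => ->; field.
(* The new basis starts with e0, e0^2, e0^3. Its last vector is e0^4 if [s != 0], giving [J4_11],
   and e3 otherwise, giving [J4_4]. *)
rewrite u0 t0; have [->|s0] := eqVneq s 0.
  newbasis [:: 1:R; 0; 0; 1]
    (row 1 0 0 0) (row 0 p p' p'') (row 0 0 (p * q) (p * q')) (row 0 0 0 1)
    (row 1 0 0 0) (row 0 p^-1 (- p' / (p ^+ 2 * q)) ((p' * q' / q - p'') / p))
    (row 0 0 (p * q)^-1 (- q' / q)) (row 0 0 0 1).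
  exact: (@classified_par 4).
newbasis [:: 1:R; 0; 0; 1; 0; 0; 1; 1]
  (row 1 0 0 0) (row 0 p p' p'') (row 0 0 (p * q) (p * q' + p' * s)) (row 0 0 0 (p * q * s))
  (row 1 0 0 0)
  (row 0 p^-1 (- p' / (p ^+ 2 * q))
    (p' * (p * q' + p' * s) / (p ^+ 3 * q ^+ 2 * s) - p'' / (p ^+ 2 * q * s)))
  (row 0 0 (p * q)^-1 (- (p * q' + p' * s) / (p ^+ 2 * q ^+ 2 * s)))
  (row 0 0 0 (p * q * s)^-1).
exact: (@classified_par 13).
Qed.

Lemma tri_jordan_cond p p' p'' q q' r r' s t u :
  is_jordan (tri_alg [:: p; p'; p''; q; q'; r; r'; s; t; u]) ->
  (if p == 0 then u = 0 \/ [/\ p' = 0, q = 0 & r = 0]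
  else [/\ r = 0, q * u = 0, q * t = 0 &
           p ^+ 2 * r' + 2 * p * p' * t + p' ^+ 2 * u = q * p * s]).
Proof.
case=> _ jord.
have {}jord x0 x1 x2 y0 y1 := jord (row x0 x1 x2 0) (row y0 y1 0 0).
have J1 := jord 1 0 0 1 0; have J2 := jord 1 0 0 0 1; have J3 := jord 1 0 1 1 0.
have J4 := jord 0 1 0 0 1; have J5 := jord 1 1 0 1 1.
move: J1 J2 J3 J4 J5; rewrite /= !tri_mulE /=.
move=> /row4_inj[_ _ J1 J1'] /row4_inj[_ _ J2 J2'] /row4_inj[_ _ J3 J3'].
move=> /row4_inj[_ _ J4 J4'] /row4_inj[_ _ J5 J5'] {jord}.
(* For [p = 0] the identity with x = y says that [u] times the squared e2-coordinate of x^2 is 0. At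
   e0, e1 and e0 + e1 that coordinate is p', r and p' + 2q + r. *)
have [p0|p0] := eqVneq p 0.
  have [u0|u0] := eqVneq u 0; [by left | right].
  rewrite p0 in J1' J4' J5'.
  have p'0 : p' = 0.
    by apply/eqP; rewrite -sqrf_eq0; apply/eqP/(mulfI u0); lra.
  have r0 : r = 0.
    by apply/eqP; rewrite -sqrf_eq0; apply/eqP/(mulfI u0); lra.
  split=> //; rewrite p'0 r0 in J5'.
  apply/eqP; rewrite -sqrf_eq0; apply/eqP/(mulfI u0).
  have : 4 * (u * q ^+ 2) = 0 by lra.
  by move/eqP; rewrite mulf_eq0 pnatr_eq0 /= mulr0 => /eqP.
(* For [p != 0], x = y = e0 compares e0^2 ∘ e0^2 with e0 ∘ (e0^2 ∘ e0): the e2-coordinate gives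
   [r0], the e3-coordinate gives [J]. Then x = e0 + e2, y = e0 gives [qu], and x = e0, y = e1 gives
   q t = 0. *)
have r0 : r = 0.
  by apply: (mulfI (expf_neq0 2 p0)); rewrite mulr0; lra.
have J : p ^+ 2 * r' + 2 * p * p' * t + p' ^+ 2 * u = q * p * s by lra.
have qu : q * u = 0.
  by apply: (mulfI p0); rewrite mulr0 r0 in J3' *; lra.
split=> //.
have p'qu : p' * (q * u) = 0 by rewrite qu mulr0.
by apply: (mulfI p0); rewrite mulr0 r0 in J2' *; lra.
Qed.

End Classification.

Lemma is_jordan_iso (K : fieldType) (A B : nalgType K) :
  nalg_iso A B -> is_jordan A -> is_jordan B.
Proof.
case=> f [g fK gK] fM [mulC jord]; split=> x y; rewrite -(gK x) -(gK y) -!fM.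
  by rewrite mulC.
by rewrite jord.
Qed.

Lemma row4_eq0 (K : fieldType) (x0 x1 x2 x3 : K) :
  (row4 x0 x1 x2 x3 == 0) = [&& x0 == 0, x1 == 0, x2 == 0 & x3 == 0].
Proof.
apply/eqP/and4P => [|[/eqP-> /eqP-> /eqP-> /eqP->]]; last exact: row4_0.
by rewrite -row4_0 => /row4_inj[-> -> -> ->].
Qed.

(** * Jordan identity, nilpotency and central components of the tables *)

Section Subspaces.
Variable K : fieldType.
Local Notation e k := (delta_mx 0 (inord k) : 'rV[K]_4).

Lemma mem_line3 (v : 'rV[K]_4) :
  reflect (exists x3, v = row4 0 0 0 x3) (v \in <[e 3]>%VS).
Proof.
apply: (iffP (vlineP _ _)) => -[x ->]; exists x; rewrite delta_row4 row4Z;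
  by rewrite !mulr0 mulr1.
Qed.

Lemma mem_plane23 (v : 'rV[K]_4) :
  reflect (exists x2 x3, v = row4 0 0 x2 x3) (v \in <[e 2]> + <[e 3]>)%VS.
Proof.
apply: (iffP memv_addP) => [[_ /vlineP[x2 ->] [_ /mem_line3[x3 ->] ->]]|[x2 [x3 ->]]].
  by exists x2, x3; rewrite delta_row4 row4Z row4D !mulr0 !add0r mulr1 addr0.
exists (x2 *: e 2); first by rewrite memvZ ?memv_line.
exists (row4 0 0 0 x3); first by apply/mem_line3; exists x3.
by rewrite delta_row4 row4Z row4D !mulr0 !add0r mulr1 addr0.
Qed.

Lemma mem_space123 (v : 'rV[K]_4) :
  reflect (exists x1 x2 x3, v = row4 0 x1 x2 x3) (v \in <[e 1]> + (<[e 2]> + <[e 3]>))%VS.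
Proof.
apply: (iffP memv_addP) => [[_ /vlineP[x1 ->] [_ /mem_plane23[x2 [x3 ->]] ->]]|[x1 [x2 [x3 ->]]]].
  by exists x1, x2, x3; rewrite delta_row4 row4Z row4D !mulr0 !add0r mulr1 addr0.
exists (x1 *: e 1); first by rewrite memvZ ?memv_line.
exists (row4 0 0 x2 x3); first by apply/mem_plane23; exists x2, x3.
by rewrite delta_row4 row4Z row4D !mulr0 !add0r mulr1 addr0.
Qed.

Lemma mem_space012 (v : 'rV[K]_4) :
  reflect (exists x0 x1 x2, v = row4 x0 x1 x2 0) (v \in <[e 0]> + (<[e 1]> + <[e 2]>))%VS.
Proof.
apply: (iffP memv_addP) => [[_ /vlineP[x0 ->]]|[x0 [x1 [x2 ->]]]].
  case=> _ /memv_addP[_ /vlineP[x1 ->] [_ /vlineP[x2 ->] ->]] ->.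
  exists x0, x1, x2; rewrite !delta_row4 !row4Z !row4D; congr row4; ring.
exists (x0 *: e 0); first by rewrite memvZ ?memv_line.
exists (row4 0 x1 x2 0); last by rewrite delta_row4 row4Z row4D; congr row4; ring.
apply/memv_addP; exists (x1 *: e 1); first by rewrite memvZ ?memv_line.
exists (x2 *: e 2); first by rewrite memvZ ?memv_line.
by rewrite !delta_row4 !row4Z row4D; congr row4; ring.
Qed.

Lemma table_nilpotent (t : table K 4) p :
  (forall x y, table_mul t x y = table_mul (tri p) x y) -> is_nilpotent (table_alg t).
Proof.
(* [cpow 1] is the whole algebra and four multiplications push it down the flag to 0, hence the
   exponent 5. *)
move=> tE; exists 5 => //; rewrite /cpow /=.
pose P3 : {vspace table_alg t} := <[e 3]>%VS.
pose P2 : {vspace table_alg t} := (<[e 2]> + <[e 3]>)%VS.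
pose P1 : {vspace table_alg t} := (<[e 1]> + (<[e 2]> + <[e 3]>))%VS.
have s1 : (nalg_prod fullv fullv <= P1)%VS.
  apply/nalg_prodP => /= u v _ _; rewrite tE.
  have [? [? [? [? ->]]]] := row4P u; have [? [? [? [? ->]]]] := row4P v.
  by rewrite tri_mulE; apply/mem_space123; do 3!eexists.
have s2 : (nalg_prod P1 fullv <= P2)%VS.
  apply/nalg_prodP => /= u v /mem_space123[? [? [? ->]]] _; rewrite tE.
  have [? [? [? [? ->]]]] := row4P v.
  by rewrite tri_mulE mul0r mulr0; apply/mem_plane23; do 2!eexists.
have s3 : (nalg_prod P2 fullv <= P3)%VS.
  apply/nalg_prodP => /= u v /mem_plane23[? [? ->]] _; rewrite tE.
  have [? [? [? [? ->]]]] := row4P v.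
  by rewrite tri_mulE !(mul0r, mulr0, addr0, add0r); apply/mem_line3; eexists.
have s4 : (nalg_prod P3 fullv <= 0)%VS.
  apply/nalg_prodP => /= u v /mem_line3[? ->] _; rewrite tE.
  have [? [? [? [? ->]]]] := row4P v.
  by rewrite tri_mulE !(mul0r, mulr0, addr0, add0r) row4_0 mem0v.
apply/eqP; rewrite -subv0; apply: subv_trans s4; apply: nalg_prodS; apply: subv_trans s3.
by apply: nalg_prodS; apply: subv_trans s2; apply: nalg_prodS.
Qed.

End Subspaces.

Definition centre_in_products (K : fieldType) (A : nalgType K) : Prop :=
  forall z : A, (forall y : A, z ∘ y == 0) -> exists x y : A, z = x ∘ y.

(** An element of [I2] is central, so it is some x ∘ y. The [I2]-part of x contributes nothing,
    being central, so the product lies in the ideal [I1] and thus in the zero intersection. *)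
Lemma central_component_centre (K : fieldType) (A : nalgType K) :
  centre_in_products A -> ~ has_central_component A.
Proof.
move=> centA [I1 [I2 [[id1 id2] [sum12 /directv_addP cap12] I20 cen2]]].
case: I20; apply/eqP; rewrite -subv0 -cap12 subv_cap subvv andbT.
apply/subvP=> z I2z; have [|x [y ->]] := centA z.
  by move=> y; rewrite cen2.
have /memv_addP[x1 I1x1 [x2 I2x2 ->]] : x \in (I1 + I2)%VS by rewrite sum12 memvf.
by rewrite linearDl /= (cen2 _ I2x2) addr0; case: (id1 x1 y I1x1).
Qed.

Section J4Algebras.
Variable R : realFieldType.

Lemma J4M (i : 'I_17) (x0 x1 x2 x3 y0 y1 y2 y3 : R) :
  (row4 x0 x1 x2 x3 : J4 R i) ∘ row4 y0 y1 y2 y3 =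
  let p := J4_par R i in
  row4 0 (p`_0 * (x0 * y0))
    (p`_1 * (x0 * y0) + p`_3 * (x0 * y1 + x1 * y0) + p`_5 * (x1 * y1))
    (p`_2 * (x0 * y0) + p`_4 * (x0 * y1 + x1 * y0) + p`_6 * (x1 * y1) +
     p`_7 * (x0 * y2 + x2 * y0) + p`_8 * (x1 * y2 + x2 * y1) + p`_9 * (x2 * y2))
  :> 'rV[R]_4.
Proof. by rewrite [LHS]J4_mulE tri_mulE. Qed.

Lemma J4P (i : 'I_17) (x : J4 R i) : exists x0 x1 x2 x3, x = row4 x0 x1 x2 x3.
Proof. exact: row4P. Qed.

Lemma J4_jordan (i : 'I_17) : is_jordan (J4 R i).
Proof.
split=> x y; have [x0 [x1 [x2 [x3 ->]]]] := J4P x; have [y0 [y1 [y2 [y3 ->]]]] := J4P y.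
  by rewrite !J4M /=; congr row4; ring.
by rewrite !J4M /=; case: i {x y}; do 17?[case=> [_ /=|]]; last by []; congr row4; ring.
Qed.

Lemma J4_nilpotent (i : 'I_17) : is_nilpotent (J4 R i).
Proof. exact: table_nilpotent (@J4_mulE R i). Qed.

Lemma J4_dim (i : 'I_17) : \dim (fullv : {vspace J4 R i}) = 4%N.
Proof. by rewrite dimvf /dim /=. Qed.

Lemma J4_has_central_component (i : 'I_17) : (i < 5)%N -> has_central_component (J4 R i).
Proof.
move=> lti.
(* No product has an e3-coordinate, so e0, e1, e2 span an ideal complementary to the central line of
   e3. *)
have [p2 p4 p6 [p7 p8 p9]] :
    [/\ (J4_par R i)`_2 = 0, (J4_par R i)`_4 = 0, (J4_par R i)`_6 = 0 &
    [/\ (J4_par R i)`_7 = 0, (J4_par R i)`_8 = 0 & (J4_par R i)`_9 = 0]].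
  by case: i lti => [[|[|[|[|[|//]]]]] lti].
have mulE := J4M i; lazy zeta in mulE; rewrite p2 p4 p6 p7 p8 p9 in mulE.
pose e k : 'rV[R]_4 := delta_mx 0 (inord k).
pose I1 : {vspace J4 R i} := (<[e 0%N]> + (<[e 1%N]> + <[e 2%N]>))%VS.
pose I2 : {vspace J4 R i} := <[e 3%N]>%VS.
have cen2 x y : x \in I2 -> x ∘ y = 0 /\ y ∘ x = 0.
  move=> /mem_line3[x3 ->]; have [y0 [y1 [y2 [y3 ->]]]] := J4P y.
  by rewrite !mulE; split; rewrite -[RHS]row4_0; congr row4; ring.
exists I1, I2; split.
- split=> x y.
    move=> /mem_space012[x0 [x1 [x2 ->]]]; have [y0 [y1 [y2 [y3 ->]]]] := J4P y.
    by rewrite !mulE !mul0r !addr0; split; apply/mem_space012; do 3!eexists.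
  by move=> I2x; have [-> ->] := cen2 x y I2x; rewrite mem0v.
- split.
    apply/vspaceP=> x; rewrite memvf; have [x0 [x1 [x2 [x3 ->]]]] := J4P x.
    apply/memv_addP; exists (row4 x0 x1 x2 0); first by apply/mem_space012; do 3!eexists.
    exists (row4 0 0 0 x3); first by apply/mem_line3; eexists.
    by rewrite row4D !addr0 add0r.
  apply/directv_addP/eqP; rewrite -subv0; apply/subvP=> x.
  rewrite memv_cap => /andP[/mem_space012[x0 [x1 [x2 ->]]] /mem_line3[x3]].
  by move=> /row4_inj[-> -> -> _]; rewrite row4_0 mem0v.
- move=> I20; have : (e 3%N : J4 R i) \in I2 by apply: memv_line.
  by rewrite I20 memv0 /e delta_row4 row4_eq0 oner_eq0 !andbF.
- by move=> x I2x y; case: (cen2 x y I2x).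
Qed.

End J4Algebras.

(** * Pairwise non-isomorphism *)

Section Invariants.
Variable K : fieldType.
Implicit Types A B : nalgType K.

Definition inv_zero A := forall x : A, x ∘ x == 0.
Definition inv_cube A := exists x y z : A, (x ∘ y) ∘ z != 0.
Definition inv_fourth_power A := exists x : A, ((x ∘ x) ∘ x) ∘ x != 0.
Definition inv_isotropic A := forall x : A, x ∘ x == 0 -> forall y : A, x ∘ y == 0.
Definition inv_domain A := forall x y : A, x ∘ y == 0 ->
  (forall z : A, x ∘ z == 0) \/ (forall z : A, y ∘ z == 0).
Definition inv_indep A := exists x y : A, forall k l,
  k *: (x ∘ x) + l *: (x ∘ y) == 0 -> k = 0 /\ l = 0.
Definition inv_nilcube_add A := forall x y : A,
  (x ∘ x) ∘ x == 0 -> (y ∘ y) ∘ y == 0 -> ((x + y) ∘ (x + y)) ∘ (x + y) == 0.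
Definition inv_nilcube_square A := forall x y : A, (x ∘ x) ∘ x == 0 -> (x ∘ x) ∘ y == 0.
(** In the notation of the cubic case, this asks for a vector of ker l with zero square that lies
    outside the radical of the form. *)
Definition inv_null_annihilator A := exists v x y : A, [/\ v ∘ v == 0,
  forall z w : A, v ∘ (z ∘ w) == 0 & (v ∘ x) ∘ y != 0].
(** In the notation of the cubic case, this asks for a vector in the radical of the form that lies
    outside ker l. *)
Definition inv_form_radical A := exists u z w : A,
  (forall x y : A, (u ∘ x) ∘ y == 0) /\ u ∘ (z ∘ w) != 0.

Definition iso_invariant (P : nalgType K -> Prop) :=
  forall A B, nalg_iso A B -> P A -> P B.

Lemma nalg_isoP A B : nalg_iso A B -> exists f : {linear A -> B},
  [/\ forall y, exists x, y = f x, forall x, (f x == 0) = (x == 0) &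
      forall x y, f (x ∘ y) = f x ∘ f y].
Proof.
case=> f fbij fM; exists f; split=> // [y|x].
  by have [g fK gK] := fbij; exists (g y); rewrite gK.
by rewrite -[0 in LHS](linear0 f) (inj_eq (bij_inj fbij)).
Qed.

Lemma inv_zero_iso : iso_invariant inv_zero.
Proof.
move=> A B /nalg_isoP[f [fS f0 fM]] h x.
by have [x' ->] := fS x; rewrite -!fM !f0.
Qed.

Lemma inv_cube_iso : iso_invariant inv_cube.
Proof.
move=> A B /nalg_isoP[f [fS f0 fM]] [x [y [z h]]].
by exists (f x), (f y), (f z); rewrite -!fM !f0.
Qed.

Lemma inv_fourth_power_iso : iso_invariant inv_fourth_power.
Proof.
move=> A B /nalg_isoP[f [fS f0 fM]] [x h].
by exists (f x); rewrite -!fM !f0.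
Qed.

Lemma inv_isotropic_iso : iso_invariant inv_isotropic.
Proof.
move=> A B /nalg_isoP[f [fS f0 fM]] h x + y.
have [x' ->] := fS x; have [y' ->] := fS y.
by rewrite -!fM !f0 => /h.
Qed.

Lemma inv_domain_iso : iso_invariant inv_domain.
Proof.
move=> A B /nalg_isoP[f [fS f0 fM]] h x y.
have [x' ->] := fS x; have [y' ->] := fS y.
by rewrite -!fM !f0 => /h[] h'; [left | right] => z; have [z' ->] := fS z; rewrite -!fM f0.
Qed.

Lemma inv_indep_iso : iso_invariant inv_indep.
Proof.
move=> A B /nalg_isoP[f [fS f0 fM]] [x [y h]].
exists (f x), (f y) => k l h0; apply: h; rewrite -f0 linearD !linearZ /=.
by rewrite !fM.
Qed.

Lemma inv_nilcube_add_iso : iso_invariant inv_nilcube_add.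
Proof.
move=> A B /nalg_isoP[f [fS f0 fM]] h x y.
have [x' ->] := fS x; have [y' ->] := fS y.
rewrite -(linearD f) -!fM !f0; exact: h.
Qed.

Lemma inv_nilcube_square_iso : iso_invariant inv_nilcube_square.
Proof.
move=> A B /nalg_isoP[f [fS f0 fM]] h x y.
have [x' ->] := fS x; have [y' ->] := fS y.
rewrite -!fM !f0; exact: h.
Qed.

Lemma inv_null_annihilator_iso : iso_invariant inv_null_annihilator.
Proof.
move=> A B /nalg_isoP[f [fS f0 fM]] [v [x [y [h1 h2 h3]]]].
exists (f v), (f x), (f y); rewrite -!fM !f0; split=> // z w.
by have [z' ->] := fS z; have [w' ->] := fS w; rewrite -!fM f0.
Qed.

Lemma inv_form_radical_iso : iso_invariant inv_form_radical.
Proof.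
move=> A B /nalg_isoP[f [fS f0 fM]] [v [x [y [h1 h2]]]].
exists (f v), (f x), (f y); rewrite -!fM !f0; split=> // z w.
by have [z' ->] := fS z; have [w' ->] := fS w; rewrite -!fM f0.
Qed.

Lemma centre_in_products_iso : iso_invariant (@centre_in_products K).
Proof.
move=> A B /nalg_isoP[f [fS f0 fM]] h z; have [z' ->] := fS z => cz.
have [|x [y ->]] := h z'; last by exists (f x), (f y).
by move=> y; rewrite -f0 fM.
Qed.

End Invariants.

(** * Evaluation of the invariant sentences on the 17 algebras *)

Section Separation.
Variable R : realFieldType.
Local Notation row := (@row4 R).

(* The numbers in [T] and [F] are indices of [J4_tables] at which [P] is checked to hold,
   respectively to fail. *)
Definition separated (P : nalgType R -> Prop) (T F : seq nat) : Prop :=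
  [/\ iso_invariant P,
      forall i : 'I_17, (i : nat) \in T -> P (J4 R i) &
      forall i : 'I_17, (i : nat) \in F -> ~ P (J4 R i)].

Lemma separated_iso P T F (i j : 'I_17) : separated P T F ->
  nalg_iso (J4 R i) (J4 R j) -> ~~ (((i : nat) \in T) && ((j : nat) \in F)).
Proof.
case=> Piso PT PF isoij; apply/negP=> /andP[iT jF].
by apply: (PF j jF); apply: Piso isoij _; apply: PT.
Qed.

Lemma row4_eq0P (x0 x1 x2 x3 : R) :
  reflect [/\ x0 = 0, x1 = 0, x2 = 0 & x3 = 0] (row4 x0 x1 x2 x3 == 0).
Proof.
rewrite row4_eq0; apply: (iffP and4P) => [[/eqP-> /eqP-> /eqP-> /eqP->]|[-> -> -> ->]] //.
Qed.

(** [Jsplit] runs through all 17 indices and discards those outside the list; [Jzero] reduces a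
    vanishing or nonvanishing claim to arithmetic in coordinates. *)
Ltac Jsplit := case=> [[|[|[|[|[|[|[|[|[|[|[|[|[|[|[|[|[|//]]]]]]]]]]]]]]]]] lti] // _.
Ltac coords x := let a := fresh x in let b := fresh x in let c := fresh x in let d := fresh x in
  have [a [b [c [d ?]]]] := J4P x; subst x.
Ltac Jmul := rewrite ?(J4M, row4D); lazy beta iota zeta delta [J4_par J4_pars nth nat_of_ord].
Ltac Jzero :=
  Jmul; first [by apply/row4_eq0P; split; lra | by apply/row4_eq0P => -[]; lra].

Lemma sep_zero : separated (@inv_zero R) [:: 0]%N [:: 1; 2; 3]%N.
Proof.
split; first exact: inv_zero_iso.
  Jsplit => x; coords x; Jzero.
by Jsplit => /(_ (row 1 0 0 0)); apply/negP; Jzero.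
Qed.

Lemma sep_cube : separated (@inv_cube R) [:: 4; 7; 8; 9; 10; 11; 12; 13]%N
   [:: 0; 1; 2; 3; 5; 6; 14; 15; 16]%N.
Proof.
split; first exact: inv_cube_iso.
  Jsplit.
1: exists (row4 1 0 0 0), (row4 1 0 0 0), (row4 1 0 0 0).
(* In [J4_6] the cube of e0 is zero, but e0^2 ∘ e2 = e3. *)
2: exists (row4 1 0 0 0), (row4 1 0 0 0), (row4 0 0 1 0).
3-8: exists (row4 1 0 0 0), (row4 1 0 0 0), (row4 1 0 0 0).
1-8: by Jzero.
Jsplit => -[x [y [z]]]; coords x; coords y; coords z; apply/negP; rewrite negbK;
  by Jzero.
Qed.

Lemma sep_fourth_power : separated (@inv_fourth_power R) [:: 13]%N [:: 4; 7; 8; 9; 10; 11; 12]%N.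
Proof.
split; first exact: inv_fourth_power_iso.
  by Jsplit; exists (row4 1 0 0 0); Jzero.
Jsplit => -[x]; coords x; apply/negP; rewrite negbK; by Jzero.
Qed.

Lemma sep_isotropic : separated (@inv_isotropic R) [:: 1; 2; 5; 15; 16]%N [:: 3; 6; 14]%N.
Proof.
split; first exact: inv_isotropic_iso.
  Jsplit=> x; coords x; Jmul => /row4_eq0P[_ e1 e2 e3] y; coords y.
  - have /eqP : x0 ^+ 2 = 0 by lra.
    by rewrite sqrf_eq0 => /eqP ?; subst x0; Jzero.
  - have /eqP : x0 ^+ 2 + x1 ^+ 2 = 0 by lra.
    by rewrite paddr_eq0 ?sqr_ge0 // !sqrf_eq0 => /andP[/eqP ? /eqP ?]; subst x0 x1; Jzero.
  - have /eqP : x0 ^+ 2 + x1 ^+ 2 + x2 ^+ 2 = 0 by lra.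
    rewrite paddr_eq0 ?addr_ge0 ?sqr_ge0 // paddr_eq0 ?sqr_ge0 // !sqrf_eq0.
    by move=> /andP[/andP[/eqP ? /eqP ?] /eqP ?]; subst x0 x1 x2; Jzero.
  - have /eqP : x0 ^+ 2 + x1 ^+ 2 = 0 by lra.
    by rewrite paddr_eq0 ?sqr_ge0 // !sqrf_eq0 => /andP[/eqP ? /eqP ?]; subst x0 x1; Jzero.
  (* In [J4_13 (-1)] the coordinates of x^2 are x0^2 - x1^2 and 2 x0 x1: the square of a complex
     number. *)
  - have /eqP : x0 * x1 = 0 by lra.
    have e : x0 ^+ 2 = x1 ^+ 2 by lra.
    rewrite mulf_eq0 => /orP[] /eqP z; rewrite z expr0n /= in e.
      have /eqP : x1 ^+ 2 = 0 by []. by rewrite sqrf_eq0 => /eqP ?; subst x0 x1; Jzero.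
    have /eqP : x0 ^+ 2 = 0 by []. by rewrite sqrf_eq0 => /eqP ?; subst x0 x1; Jzero.
Jsplit=> h.
- have z : (row 1 1 0 0 : J4 R (Ordinal lti)) ∘ row 1 1 0 0 == 0 by Jzero.
  by move: (h _ z (row 1 0 0 0)); apply/negP; Jzero.
- have z : (row 1 0 1 0 : J4 R (Ordinal lti)) ∘ row 1 0 1 0 == 0 by Jzero.
  by move: (h _ z (row 1 0 0 0)); apply/negP; Jzero.
- have z : (row 0 1 0 0 : J4 R (Ordinal lti)) ∘ row 0 1 0 0 == 0 by Jzero.
  by move: (h _ z (row 1 0 0 0)); apply/negP; Jzero.
Qed.

Lemma sep_domain : separated (@inv_domain R) [:: 1; 16]%N [:: 2; 5; 15]%N.
Proof.
split; first exact: inv_domain_iso.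
  Jsplit=> x y; coords x; coords y; Jmul => /row4_eq0P[_ e1 e2 e3].
  - have /eqP : x0 * y0 = 0 by lra.
    by rewrite mulf_eq0 => /orP[] /eqP ?; [left | right] => z; coords z; subst; Jzero.
  (* Products in [J4_13 (-1)] are those of complex numbers, so the norm is multiplicative. *)
  - have /eqP : (x0 ^+ 2 + x1 ^+ 2) * (y0 ^+ 2 + y1 ^+ 2) = 0.
      have -> : (x0 ^+ 2 + x1 ^+ 2) * (y0 ^+ 2 + y1 ^+ 2) =
        (x0 * y0 - x1 * y1) ^+ 2 + (x0 * y1 + x1 * y0) ^+ 2 by ring.
      have -> : x0 * y0 - x1 * y1 = 0 by lra.
      have -> : x0 * y1 + x1 * y0 = 0 by lra.
      by rewrite expr0n addr0.
    rewrite mulf_eq0 !paddr_eq0 ?sqr_ge0 // !sqrf_eq0.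
    by move=> /orP[] /andP[/eqP ? /eqP ?]; [left | right] => z; coords z; subst; Jzero.
Jsplit=> h.
- have [||/(_ (row 0 1 0 0))] := h (row 1 0 0 0) (row 0 1 0 0); first by Jzero.
    by move/(_ (row 1 0 0 0)); apply/negP; Jzero.
  by apply/negP; Jzero.
- have [||/(_ (row 0 1 0 0))] := h (row 1 0 0 0) (row 0 1 0 0); first by Jzero.
    by move/(_ (row 1 0 0 0)); apply/negP; Jzero.
  by apply/negP; Jzero.
- have [||/(_ (row 1 0 0 0))] := h (row 1 1 0 0) (row 1 (-1) 0 0); first by Jzero.
    by move/(_ (row 1 0 0 0)); apply/negP; Jzero.
  by apply/negP; Jzero.
Qed.

Lemma sep_indep : separated (@inv_indep R) [:: 14; 15]%N [:: 5; 6]%N.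
Proof.
split; first exact: inv_indep_iso.
  Jsplit; exists (row 1 0 0 0), (row 0 1 0 0) => k l; Jmul;
    by rewrite !row4Z row4D => /row4_eq0P[]; lra.
Jsplit=> -[x [y]]; coords x; coords y; Jmul.
(* All products lie on one line, so the two coefficients, exchanged with a sign, give a relation.
   Independence makes both zero; then x^2 = 0, and the pair (1, 0) is a forbidden relation. *)
- move=> h; have [|b0 a0] := h (x0 * y0 + x1 * y1 + x2 * y2) (- (x0 * x0 + x1 * x1 + x2 * x2)).
    by rewrite !row4Z row4D; apply/row4_eq0P; split; ring.
  have [|/eqP] := h 1 0; last by rewrite oner_eq0.
  by rewrite !row4Z row4D; apply/row4_eq0P; split; lra.
- move=> h; have [|b0 a0] := h (x0 * y0 + x1 * y1 - x2 * y2) (- (x0 * x0 + x1 * x1 - x2 * x2)).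
    by rewrite !row4Z row4D; apply/row4_eq0P; split; ring.
  have [|/eqP] := h 1 0; last by rewrite oner_eq0.
  by rewrite !row4Z row4D; apply/row4_eq0P; split; lra.
Qed.

(** The cube of x is a cubic form times e3. For indices 8 and 9 it is x0^3 and (x0^2 + x1^2) x0,
    with real zeros the hyperplane x0 = 0. The forms x0^2 x2, (x0^2 - x1^2) x0 and (x0 + x1)^2 (x0 -
    x1) of the others have zeros whose sum is not a zero. *)
Lemma sep_nilcube_add : separated (@inv_nilcube_add R) [:: 8; 9]%N [:: 7; 10; 11; 12]%N.
Proof.
split; first exact: inv_nilcube_add_iso.
  Jsplit=> x y; coords x; coords y; Jmul => /row4_eq0P[_ _ _ ex] /row4_eq0P[_ _ _ ey].
  - have /eqP : x0 ^+ 3 = 0 by lra.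
    have /eqP : y0 ^+ 3 = 0 by lra.
    by rewrite !expf_eq0 /= => /eqP ? /eqP ?; subst x0 y0; Jzero.
  - have cube0 (a b : R) : (a ^+ 2 + b ^+ 2) * a = 0 -> a = 0.
      move=> /eqP; rewrite mulf_eq0 paddr_eq0 ?sqr_ge0 // !sqrf_eq0.
      by move=> /orP[/andP[/eqP]|/eqP].
    have x00 : x0 = 0 by apply: (cube0 _ x1); lra.
    have y00 : y0 = 0 by apply: (cube0 _ y1); lra.
    by subst x0 y0; Jzero.
Jsplit=> h.
- by apply: (elimN idP _ (h (row 1 0 0 0) (row 0 0 1 0) _ _)); Jzero.
- by apply: (elimN idP _ (h (row 1 1 0 0) (row 1 (-1) 0 0) _ _)); Jzero.
- by apply: (elimN idP _ (h (row 1 1 0 0) (row 1 (-1) 0 0) _ _)); Jzero.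
- by apply: (elimN idP _ (h (row 1 1 0 0) (row 1 (-1) 0 0) _ _)); Jzero.
Qed.

(** For indices 11 and 12 the zeros of the cubic form are those of x0^2 - x1^2, the e2-coordinate of
    x^2, so x^2 is central there. For 9 and 10 the cube of e1 is zero but its square is e2 up to
    sign, which is not central. *)
Lemma sep_nilcube_square :
  separated (@inv_nilcube_square R) [:: 8; 11; 12]%N [:: 7; 9; 10]%N.
Proof.
split; first exact: inv_nilcube_square_iso.
  Jsplit=> x y; coords x; coords y; Jmul => /row4_eq0P[_ _ _ ex].
  - have /eqP : x0 ^+ 3 = 0 by lra.
    by rewrite !expf_eq0 /= => /eqP ?; subst x0; Jzero.
  - have : (x0 + x1) ^+ 2 * (x0 - x1) = 0 by lra.
    move=> /eqP; rewrite mulf_eq0 sqrf_eq0 addr_eq0 subr_eq0 => /orP[] /eqP ?; subst x0;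
      by Jzero.
  - have : (x0 + x1) ^+ 2 * (x0 - x1) = 0 by lra.
    move=> /eqP; rewrite mulf_eq0 sqrf_eq0 addr_eq0 subr_eq0 => /orP[] /eqP ?; subst x0;
      by Jzero.
Jsplit=> h.
- by apply: (elimN idP _ (h (row 1 0 0 0) (row 0 0 1 0) _)); Jzero.
- by apply: (elimN idP _ (h (row 0 1 0 0) (row 1 0 0 0) _)); Jzero.
- by apply: (elimN idP _ (h (row 0 1 0 0) (row 1 0 0 0) _)); Jzero.
Qed.

Lemma sep_null_annihilator : separated (@inv_null_annihilator R) [:: 11]%N [:: 12]%N.
Proof.
split; first exact: inv_null_annihilator_iso.
  Jsplit; exists (row 1 (-1) 0 0), (row 1 0 0 0), (row 1 0 0 0); split; try by Jzero.
  by move=> z w; coords z; coords w; Jzero.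
Jsplit=> -[v [x [y [+ h]]]]; coords v; coords x; coords y; Jmul.
move: (h (row 1 0 0 0) (row 1 0 0 0)); Jmul.
move=> /row4_eq0P[_ _ _ c3] /row4_eq0P[_ _ c2 d3] /negP[].
(* This expresses that v annihilates e0^2 = e2. The e3-coordinate of v^2 is then -2 v1^2. *)
have v01 : v0 = - v1 by lra.
subst v0; have /eqP : v1 ^+ 2 = 0 by lra.
by rewrite sqrf_eq0 => /eqP ?; subst v1; Jzero.
Qed.

Lemma sep_form_radical : separated (@inv_form_radical R) [:: 7]%N [:: 10]%N.
Proof.
split; first exact: inv_form_radical_iso.
  Jsplit; exists (row 0 0 1 0), (row 1 0 0 0), (row 1 0 0 0); split; try by Jzero.
  by move=> z w; coords z; coords w; Jzero.
Jsplit=> -[u [z [w [h]]]]; coords u; coords z; coords w; Jmul.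
move: (h (row 1 0 0 0) (row 1 0 0 0)) (h (row 0 1 0 0) (row 1 0 0 0)); Jmul.
move=> /row4_eq0P[_ _ _ c0] /row4_eq0P[_ _ _ c1] /negP[].
have ? : u0 = 0 by lra.
have ? : u1 = 0 by lra.
by subst; Jzero.
Qed.

Ltac Jeq := Jmul; congr row4; lra.

Lemma sep_centre : separated (@centre_in_products R)
  [:: 5; 6; 7; 8; 9; 10; 11; 12; 13; 14; 15; 16]%N [:: 0; 1; 2; 3; 4]%N.
Proof.
split; first exact: centre_in_products_iso.
  Jsplit=> z; coords z => h.
  (* Products with e0, e1, e2 force z onto the line of e3 or, in the last three algebras, into the
     plane of e2 and e3, which consists of the products e0 ∘ (z2 e0 + z3 e1). *)
  1-12: move: (h (row 1 0 0 0)) (h (row 0 1 0 0)) (h (row 0 0 1 0)) => {h}; Jmul.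
  1-12: move=> /row4_eq0P[? ? ? ?] /row4_eq0P[? ? ? ?] /row4_eq0P[? ? ? ?].
  1-2: by exists (row z3 0 0 0), (row 1 0 0 0); Jeq.
  1: by exists (row 0 z3 0 0), (row 0 0 1 0); Jeq.
  1: by exists (row z3 0 0 0), (row 0 1 0 0); Jeq.
  1-5: by exists (row z3 0 0 0), (row 0 0 1 0); Jeq.
  1-3: by exists (row 1 0 0 0), (row z2 z3 0 0); Jeq.
Jsplit=> h.
all: have [|x [y]] := h (row 0 0 0 1); first (by move=> z; coords z; Jzero).
all: by coords x; coords y; Jmul => /row4_inj[]; lra.
Qed.

End Separation.

Section Noniso.
Variable R : realFieldType.

Lemma J4_iso_inj (i j : 'I_17) : nalg_iso (J4 R i) (J4 R j) -> i = j.
Proof.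
pose T := [:: [:: 0]; [:: 4; 7; 8; 9; 10; 11; 12; 13]; [:: 13]; [:: 1; 2; 5; 15; 16];
  [:: 1; 16]; [:: 14; 15]; [:: 8; 9]; [:: 8; 11; 12]; [:: 11]; [:: 7];
  [:: 5; 6; 7; 8; 9; 10; 11; 12; 13; 14; 15; 16]]%N.
pose F := [:: [:: 1; 2; 3]; [:: 0; 1; 2; 3; 5; 6; 14; 15; 16]; [:: 4; 7; 8; 9; 10; 11; 12];
  [:: 3; 6; 14]; [:: 2; 5; 15]; [:: 5; 6]; [:: 7; 10; 11; 12]; [:: 7; 9; 10]; [:: 12];
  [:: 10]; [:: 0; 1; 2; 3; 4]]%N.
move=> isoij; pose sep (x y : nat) (p : seq nat * seq nat) := (x \in p.1) && (y \in p.2).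
have no (x y : 'I_17) : nalg_iso (J4 R x) (J4 R y) -> ~~ has (sep x y) (zip T F).
  move=> isoxy; rewrite /T /F /sep [has _ _]/= orbF.
  rewrite !(negPf (separated_iso (sep_zero R) isoxy), negPf (separated_iso (sep_cube R) isoxy),
    negPf (separated_iso (sep_fourth_power R) isoxy), negPf (separated_iso (sep_isotropic R) isoxy),
    negPf (separated_iso (sep_domain R) isoxy), negPf (separated_iso (sep_indep R) isoxy),
    negPf (separated_iso (sep_nilcube_add R) isoxy),
    negPf (separated_iso (sep_nilcube_square R) isoxy),
    negPf (separated_iso (sep_null_annihilator R) isoxy),
    negPf (separated_iso (sep_form_radical R) isoxy), negPf (separated_iso (sep_centre R) isoxy)) //.
(* A finite check: any two distinct indices are separated by one of the eleven sentences, in one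
   direction or the other. *)
have all_sep : all (fun x => all (fun y => (x == y) || has (sep x y) (zip T F)
    || has (sep y x) (zip T F)) (iota 0 17)) (iota 0 17) by vm_compute.
have mem_i (x : 'I_17) : (x : nat) \in iota 0 17 by rewrite mem_iota ltn_ord.
have := allP (allP all_sep i (mem_i i)) j (mem_i j).
by rewrite (negPf (no i j isoij)) (negPf (no j i (nalg_iso_sym isoij))) !orbF => /eqP/val_inj.
Qed.

End Noniso.

Local Close Scope nalg_scope.
Local Close Scope ring_scope.

Theorem theorem39 (R : realType) :
  [/\ (forall i : 'I_17,
        [/\ is_jordan (J4 R i),
            is_nilpotent (J4 R i) &
            \dim (fullv : {vspace J4 R i}) = 4]),
      (forall i : 'I_17,
        has_central_component (J4 R i) <-> (i < 5)%N),
      (forall i j : 'I_17,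
        nalg_iso (J4 R i) (J4 R j) -> i = j) &
      (forall J : nalgType R,
        is_jordan J -> is_nilpotent J -> \dim (fullv : {vspace J}) = 4 ->
        exists i : 'I_17, nalg_iso J (J4 R i))].
Proof.
split.
- by move=> i; split; [exact: J4_jordan | exact: J4_nilpotent | exact: J4_dim].
- move=> i; split=> [hasC|]; last exact: J4_has_central_component.
  rewrite ltnNge; apply/negP=> le5i; apply: central_component_centre hasC.
  have [_ centT _] := sep_centre R; apply: centT.
  by case: i le5i => [[|[|[|[|[|[|[|[|[|[|[|[|[|[|[|[|[|//]]]]]]]]]]]]]]]]] lti].
- exact: J4_iso_inj.
- move=> J jordJ nilJ dimJ.
  have [p [p' [p'' [q [q' [r [r' [s [t [u isoJ]]]]]]]]]] :=
    nilpotent_nalg_iso_tri nilJ jordJ.1 dimJ.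
  have [|i isoi] := @classified_tri R p p' p'' q q' r r' s t u.
    exact/tri_jordan_cond/(is_jordan_iso isoJ).
  by exists i; apply: nalg_iso_trans isoJ isoi.
Qed.
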